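(* Let $K\ge 2$ and $T\ge 1$ be integers, and let $R$ denote the regret of the Accounts algorithm (defined in the context) for the $K$-armed bandit on any adaptively chosen cost sequence of length $T$. Then, for every real $\alpha>1$, $$\Pr\left(R\ge(\alpha+7)\sqrt{TK\ln K}\right)\le 1000\,K\sqrt{\alpha}\,\exp\left(-\frac{\sqrt{\alpha}\,\ln K}{8}\right).$$ It follows that $\mathbf{E}(R)=O(\sqrt{TK\ln K})$, i.e. there is an absolute constant $C$ (independent of $T$, $K$ and of the adaptive cost sequence) such that $\mathbf{E}(R)\le C\sqrt{TK\ln K}$.
   Context: Game. A gambler and a casino (adversary) play $T$ rounds. In round $i$ the gambler chooses an arm $M^i\in\{1,\dots,K\}$ while the adversary simultaneously chooses costs $c^i_1,\dots,c^i_K\in[0,1]$. The gambler then observes only $c^i_{M^i}$, and the adversary learns $M^i$. The cost sequence is adaptively chosen: $c^i=(c^i_1,\dots,c^i_K)$ may depend arbitrarily on $M^1,\dots,M^{i-1}$ (and possibly on the adversary's own private randomness), but the gambler's randomization in round $i$ is independent of the costs being set for round $i$ (given the past). The regret is $$R=\sum_{i=1}^T c^i_{M^i}-\min_{1\le j\le K}\sum_{i=1}^T c^i_j .$$ Accounts algorithm. Let $\eta=\sqrt{\ln K/(TK)}$ and $\theta=\sqrt{KT\ln K}$. For $z\in\mathbb{R}^K$ let $f_j(z)=e^{-\eta z_j}/\sum_{\ell=1}^K e^{-\eta z_\ell}$, and for $x\ge 0$ let $g(x)=\max\{\eta,\ 1/(K(1+x/\theta)^{3/2})\}$. The algorithm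 maintains vectors $\widehat{\mathbf C},\mathbf A\in\mathbb{R}^K$, both initialized to $\mathbf 0$. In each round $i=1,\dots,T$: (1) set $\mathbf p=(p_1,\dots,p_K)=f(\widehat{\mathbf C})$; (2) sample $M=M^i\in\{1,\dots,K\}$ according to the distribution $\mathbf p$ (using fresh randomness), pull arm $M$, and observe and incur the cost $c^i_M$; (3) if $g(A_M)\le p_M$, replace $\widehat C_M$ by $\widehat C_M+c^i_M/p_M$; otherwise replace $A_M$ by $A_M+c^i_M/p_M$. All other coordinates are unchanged. *)

(* Defs.v *)
From HB Require Import structures.
From mathcomp Require Export all_boot all_order all_algebra.
From mathcomp Require Export all_classical all_reals all_analysis.

Set Implicit Arguments.
Unset Strict Implicit.
Unset Printing Implicit Defensive.

Import Order.TTheory GRing.Theory Num.Theory.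

Local Open Scope classical_set_scope.
Local Open Scope ring_scope.

(* Rounds are numbered 0, ..., T-1 and arms are the elements of 'I_K. *)

Definition eta (R : realType) (K T : nat) : R :=
  Num.sqrt (ln K%:R / (T%:R * K%:R)).

Definition theta (R : realType) (K T : nat) : R :=
  Num.sqrt (K%:R * T%:R * ln K%:R).

Definition weights (R : realType) (K T : nat) (z : 'rV[R]_K) : 'rV[R]_K :=
  \row_j (expR (- eta R K T * z 0 j) /
          \sum_(l < K) expR (- eta R K T * z 0 l)).

Definition threshold (R : realType) (K T : nat) (x : R) : R :=
  Num.max (eta R K T) (1 / (K%:R * (1 + x / theta R K T) `^ (3 / 2))).

(* One round of the algorithm: [s] is the pair (Chat, A), [m] the arm pulled
   and [x] the cost incurred. *)
Definition accounts_step (R : realType) (K T : nat)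
    (m : 'I_K) (x : R) (s : 'rV[R]_K * 'rV[R]_K) : 'rV[R]_K * 'rV[R]_K :=
  let p := weights T s.1 in
  let incr := (x / p 0 m) *: delta_mx 0 m in
  if threshold K T (s.2 0 m) <= p 0 m
  then (s.1 + incr, s.2)
  else (s.1, s.2 + incr).

(* The pair (Chat, A) at the beginning of round [i], when arm [m l] was pulled
   and cost [x l] was observed in every round [l < i]. *)
Fixpoint accounts_state (R : realType) (K T : nat)
    (m : nat -> 'I_K) (x : nat -> R) (i : nat) : 'rV[R]_K * 'rV[R]_K :=
  if i is l.+1 then accounts_step T (m l) (x l) (accounts_state T m x l)
  else (0, 0).

Definition accounts_prob (R : realType) (K T : nat)
    (m : nat -> 'I_K) (x : nat -> R) (i : nat) : 'rV[R]_K :=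
  weights T (accounts_state T m x i).1.

(* A play of the accounts algorithm against an adaptive, possibly randomized,
   adversary, as random variables on a probability space: [M i w] is the arm
   pulled and [c i j w] the cost of arm [j] in round [i].  The event system
   [G i] is the information available just before the gambler samples [M i]:
   it contains the arms and costs of the earlier rounds, the costs set for
   round [i], and whatever private randomness the adversary has used so far.
   No further restriction is put on how [c i] depends on that information.
   [play_sample] says that P(M i = j | G i) = p_j, where p is the distribution
   computed by the algorithm from its own observations; in particular the
   arm is drawn independently of the costs of round [i] given the past. *)
Record accounts_play (d : measure_display) (Omega : measurableType d)
    (R : realType) (P : probability Omega R) (K T : nat)
    (G : nat -> set (set Omega))
    (M : nat -> Omega -> 'I_K) (c : nat -> 'I_K -> Omega -> R) : Prop :=
  AccountsPlay {
    play_sigma : forall i, (i <= T)%N -> sigma_algebra setT (G i);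
    play_measurable : forall i, (i <= T)%N -> G i `<=` measurable;
    play_mono : forall i, (i < T)%N -> G i `<=` G i.+1;
    play_cost : forall i j (B : set R), (i < T)%N ->
      measurable B -> G i (c i j @^-1` B);
    play_cost_bound : forall i j w, (i < T)%N -> 0 <= c i j w <= 1;
    play_arm : forall i j, (i < T)%N -> G i.+1 (M i @^-1` [set j]);
    play_sample : forall i j (E : set Omega), (i < T)%N -> G i E ->
      P (E `&` M i @^-1` [set j]) =
        (\int[P]_(w in E)
          (accounts_prob T (M ^~ w) (fun l => c l (M l w) w) i 0%R j)%:E)%E
  }.

(* For [0 < K] the [inf] is over a nonempty finite set, hence it is the
   minimum. *)
Definition regret (Omega : Type) (R : realType) (K T : nat)
    (M : nat -> Omega -> 'I_K) (c : nat -> 'I_K -> Omega -> R)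
    (w : Omega) : R :=
  \sum_(i < T) c i (M i w) w - inf (range (fun j : 'I_K => \sum_(i < T) c i j w)).

(* Main.v *)
Require Import Defs.
From mathcomp Require Import measurable_realfun ring lra.
Set Implicit Arguments.
Unset Strict Implicit.
Unset Printing Implicit Defensive.
Import Order.TTheory GRing.Theory Num.Theory.
Local Open Scope classical_set_scope.
Local Open Scope ring_scope.

(* Write L = ln K, so that eta theta = L and eta K T = theta.  If alpha <= 64
   the bound exceeds 1, and if theta < (alpha + 7) K L the regret is at most
   T < (alpha + 7) theta; otherwise every path satisfies the following.

   - The probability p_j drops only in rounds where p_j >= g(A_j), by a factor
     at most e < 3, hence p_j >= g(A_j) / 3 always.
   - The exponential weights analysis bounds the cost of the rounds charged to
     Chat by Chat_j + theta + eta sum Chat, and the decrease of the potential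
     sum_j (1 + A_j / theta)^(-1/2) bounds the cost of the rounds charged to A
     by 3 theta + eta sum A.  So the total cost is at most
     Chat_j + 4 theta + eta S for every arm j, where S = sum (Chat + A).

   Therefore a regret of (alpha + 7) theta forces eta S >= 3 theta or
   Chat_j - C_j >= alpha theta for the best arm j of true cost C_j.  The first
   event is rare by a Chernoff bound.  For the second, Chat_j + A_j - C_j is a
   martingale that has to exceed alpha theta + A_j, while its increments have
   conditional variance at most 1 / p_j <= 3 K (1 + A_j / theta)^(3/2): peel
   over the values of A_j and apply a Chernoff bound on each peel.
   Summing the tail bound over the integers alpha >= 256 bounds E(R). *)

(** * Measurability of functions with respect to an event system *)

(** Stated on the sigma-algebra generated by [G], so that the usual closure properties of measurable
    functions apply verbatim; when [G] is a sigma-algebra, generating adds nothing. *)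
Definition gmeasurable (Omega : pointedType) (R : realType)
    (G : set (set Omega)) (f : Omega -> R) : Prop :=
  @measurable_fun _ _ (g_sigma_algebraType G) R setT f.

Lemma gmeasurableP (Omega : pointedType) (R : realType)
    (G : set (set Omega)) (f : Omega -> R) :
  sigma_algebra setT G ->
  gmeasurable G f <-> (forall B, measurable B -> G (f @^-1` B)).
Proof.
move=> sG; split => [mf B mB|mf _ B mB].
  have := mf measurableT B mB; rewrite setTI /measurable/=.
  by rewrite (sigma_algebra_id sG).
by rewrite setTI /measurable/= (sigma_algebra_id sG); exact: mf.
Qed.

Lemma gmeasurable_sub (Omega : pointedType) (R : realType)
    (G H : set (set Omega)) (f : Omega -> R) :
  sigma_algebra setT G -> sigma_algebra setT H -> G `<=` H ->
  gmeasurable G f -> gmeasurable H f.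
Proof.
move=> sG sH GH /(gmeasurableP _ sG) mf; apply/(gmeasurableP _ sH) => B mB.
exact/GH/mf.
Qed.

Lemma gmeasurable_measurable (d : measure_display) (Omega : measurableType d)
    (R : realType) (G : set (set Omega)) (f : Omega -> R) :
  sigma_algebra setT G -> G `<=` measurable ->
  gmeasurable G f -> measurable_fun setT f.
Proof.
move=> sG mG /(gmeasurableP _ sG) mf _ B mB.
by rewrite setTI; exact/mG/mf.
Qed.

(** A preimage splits into finitely many pieces according to the value of [M], and on each piece the
    selected function is fixed. *)
Lemma gmeasurable_select (Omega : pointedType) (R : realType)
    (G : set (set Omega)) (I : finType) (M : Omega -> I)
    (f : I -> Omega -> R) :
  sigma_algebra setT G -> (forall j, G (M @^-1` [set j])) ->
  (forall j, gmeasurable G (f j)) -> gmeasurable G (fun w => f (M w) w).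
Proof.
move=> sG mM mf _ B mB; rewrite setTI.
have -> : (fun w => f (M w) w) @^-1` B =
    \big[setU/set0]_(j : I) (M @^-1` [set j] `&` f j @^-1` B).
  apply/seteqP; split => w /=.
    by move=> Bw; rewrite -bigcup_seq; exists (M w) => //=; rewrite mem_index_enum.
  by rewrite -bigcup_seq => -[j _ /= [-> ]].
apply: bigsetU_measurable => j _; apply: measurableI.
  by rewrite /measurable/= (sigma_algebra_id sG); exact: mM.
by rewrite -[X in measurable X]setTI; exact: mf.
Qed.

(** * Conditional probabilities integrated against functions *)

Section sampling.
Context (d : measure_display) (Omega : measurableType d) (R : realType).
Variables (P : probability Omega R) (G : set (set Omega)).
Hypotheses (sG : sigma_algebra setT G) (mG : G `<=` measurable).
Import HBNNSimple.

(** The hypothesis says that [q] is the conditional probability of [B] given [G]; it passes from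
    events of [G] to simple functions by linearity, then to [f] by monotone convergence. *)
Lemma integral_sample (B : set Omega) (q f : Omega -> R) :
  measurable B -> gmeasurable G q -> (forall w, 0 <= q w) ->
  (forall E, G E -> P (E `&` B) = \int[P]_(w in E) (q w)%:E)%E ->
  gmeasurable G f -> (forall w, 0 <= f w) ->
  (\int[P]_w (f w * \1_B w)%:E = \int[P]_w (f w * q w)%:E)%E.
Proof.
move=> mB mq q0 PB mf f0.
(* Typing [f] over the sigma-algebra of [G] makes its simple approximations [G]-measurable, so that
   their level sets are events to which the hypothesis on [E] applies. *)
pose fG : g_sigma_algebraType G -> R := f.
have mf' : measurable_fun [set: g_sigma_algebraType G] (EFin \o fG).
  exact/measurable_EFinP.
have mqO := gmeasurable_measurable sG mG mq.
pose h := nnsfun_approx measurableT mf'.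
have hf w : EFin \o h^~ w @ \oo --> (f w)%:E.
  by apply: cvg_nnsfun_approx => // x _; rewrite lee_fin.
have mh n : measurable_fun setT (h n : Omega -> R).
  by apply: (gmeasurable_measurable sG mG); exact: measurable_funP.
have ndh w a b : (a <= b)%N -> h a w <= h b w.
  by move=> ab; exact/lefP/nd_nnsfun_approx.
have lim_int (g : Omega -> R) : (forall w, 0 <= g w) -> measurable_fun setT g ->
    (\int[P]_w (f w * g w)%:E = limn (fun n => \int[P]_w (h n w * g w)%:E))%E.
  move=> g0 mg.
  have fg w : ((f w * g w)%:E = limn (fun n => (h n w * g w)%:E))%E.
    apply/esym/cvg_lim => //; rewrite EFinM.
    under eq_fun do rewrite EFinM.
    by apply: cvgeZr => //; exact: hf.
  under eq_integral => x _ do rewrite fg.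
  apply: monotone_convergence => //.
  - by move=> n; apply/measurable_EFinP; exact: measurable_funM.
  - by move=> n w _; rewrite lee_fin mulr_ge0.
  - by move=> w _ a b ab; rewrite lee_fin ler_wpM2r// ndh.
have mhr n r : G (h n @^-1` [set r]).
  have gh : gmeasurable G (h n) by exact: measurable_funP.
  by have /(gmeasurableP _ sG) := gh; exact.
rewrite (lim_int (\1_B))//; rewrite (lim_int q)//.
congr (limn _); apply/funext => n.
have expand (g : Omega -> R) : (forall w, 0 <= g w) -> measurable_fun setT g ->
  (\int[P]_w (h n w * g w)%:E =
   \sum_(y \in range (h n)) y%:E *
      \int[P]_w (\1_(h n @^-1` [set y]) w * g w)%:E)%E.
  move=> g0 mg.
  under eq_integral => w _.
    rewrite EFinM (fimfunE (h n) w) -fsumEFin//.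
    rewrite ge0_mule_fsuml; last by move=> y; exact: nnfun_muleindic_ge0.
    over.
  rewrite ge0_integral_fsum//; last 2 first.
  - move=> y; apply/measurable_EFinP; apply: measurable_funM => //.
    apply: measurable_funM => //; apply: measurable_indic; exact/mG/mhr.
  - by move=> m y _; rewrite mule_ge0 ?lee_fin//; exact: nnfun_muleindic_ge0.
  apply: eq_fsbigr => r rhn.
  rewrite -ge0_integralZl//.
  - by apply: eq_integral => w _; rewrite EFinM -muleA.
  - apply/measurable_EFinP; apply: measurable_funM => //.
    by apply: measurable_indic; exact/mG/mhr.
  - by move=> w _; rewrite lee_fin mulr_ge0.
  - by move: rhn; rewrite inE => -[t _ <-]; rewrite lee_fin.
rewrite !expand//; apply: eq_fsbigr => r _; congr (_ * _)%E.
pose Er : set Omega := h n @^-1` [set r].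
have mEr : measurable Er by exact/mG/mhr.
transitivity (\int[P]_w (\1_(Er `&` B) w)%:E)%E.
  by apply: eq_integral => w _; rewrite indicI.
rewrite integral_indic//; last exact: measurableI.
rewrite setIT.
transitivity (\int[P]_(w in Er) (q w)%:E)%E; first exact: (PB Er (mhr n r)).
rewrite [LHS]integral_mkcond; apply: eq_integral => w _.
rewrite patchE indicE; case: ifPn => /= _; first by rewrite mul1r.
by rewrite mul0r.
Qed.

End sampling.

Lemma gmeasurableM (Omega : pointedType) (R : realType)
    (G : set (set Omega)) (f g : Omega -> R) :
  gmeasurable G f -> gmeasurable G g -> gmeasurable G (fun w => f w * g w).
Proof. exact: measurable_funM. Qed.

(** * Exponential supermartingales and their tails *)

Section sampled_product.
Context (d : measure_display) (Omega : measurableType d) (R : realType).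
Variables (P : probability Omega R) (T : nat) (I : finType).
Variables (G : nat -> set (set Omega)) (M : nat -> Omega -> I).
Variables (p Y : nat -> I -> Omega -> R) (q : R).
Hypotheses
  (sG : forall i, (i <= T)%N -> sigma_algebra setT (G i))
  (mG : forall i, (i <= T)%N -> G i `<=` measurable)
  (GS : forall i, (i < T)%N -> G i `<=` G i.+1)
  (mM : forall i j, (i < T)%N -> G i.+1 (M i @^-1` [set j]))
  (mp : forall i j, (i < T)%N -> gmeasurable (G i) (p i j))
  (p0 : forall i j w, (i < T)%N -> 0 <= p i j w)
  (PM : forall i j E, (i < T)%N -> G i E ->
     P (E `&` M i @^-1` [set j]) = (\int[P]_(w in E) (p i j w)%:E)%E)
  (mY : forall i j, (i < T)%N -> gmeasurable (G i) (Y i j))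
  (Y0 : forall i j w, (i < T)%N -> 0 <= Y i j w)
  (pY : forall i w, (i < T)%N -> \sum_j p i j w * Y i j w <= q).

Let V i w := \prod_(l < i) Y l (M l w) w.

Let V0 i w : (i <= T)%N -> 0 <= V i w.
Proof.
by move=> iT; apply: prodr_ge0 => l _; apply: Y0; exact: leq_trans iT.
Qed.

Lemma gmeasurable_sampled i (f : I -> Omega -> R) : (i < T)%N ->
  (forall j, gmeasurable (G i) (f j)) ->
  gmeasurable (G i.+1) (fun w => f (M i w) w).
Proof.
move=> iT mf; apply: gmeasurable_select; first exact: sG.
- by move=> j; exact: mM.
- by move=> j; apply: gmeasurable_sub (GS iT) (mf j); apply: sG => //; exact: ltnW.
Qed.

Let mV i : (i <= T)%N -> gmeasurable (G i) (V i).
Proof.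
elim: i => [_|i IH iT].
  rewrite (_ : V 0 = cst 1); last by apply/funext => w; rewrite /V big_ord0.
  exact: measurable_cst.
rewrite (_ : V i.+1 = (fun w => V i w * Y i (M i w) w)); last first.
  by apply/funext => w; rewrite /V big_ord_recr.
apply: gmeasurableM.
  by apply: gmeasurable_sub (GS iT) (IH (ltnW iT)); apply: sG => //; exact: ltnW.
by apply: gmeasurable_sampled => // j; exact: mY.
Qed.

Let VO i : (i <= T)%N -> measurable_fun setT (V i).
Proof.
by move=> iT; apply: gmeasurable_measurable (mV iT); [exact: sG|exact: mG].
Qed.

(** Given [G i], the factor of round [i] has conditional mean at most [q]: split it over the arms,
    replace each indicator by its conditional probability [p i j], and use [pY]. *)
Lemma integral_sampled_prod i : (i <= T)%N ->
  (\int[P]_w (\prod_(l < i) Y l (M l w) w)%:E <= (q ^+ i)%:E)%E.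
Proof.
rewrite -/(V i); elim: i => [_|i IH iT].
  under eq_integral do rewrite big_ord0.
  by rewrite integral_cst//= mul1e probability_setT.
have iT' := ltnW iT.
have mMi j : measurable (M i @^-1` [set j]) by apply: (mG iT); exact: mM.
have toO f : gmeasurable (G i) f -> measurable_fun setT f.
  by apply: gmeasurable_measurable; [exact: sG|exact: mG].
have q0 : 0 <= q.
  by apply: le_trans (pY point iT); apply: sumr_ge0 => j _; rewrite mulr_ge0// ?p0 ?Y0.
have -> : (\int[P]_w (V i.+1 w)%:E =
    \int[P]_w \sum_j (V i w * Y i j w * \1_(M i @^-1` [set j]) w)%:E)%E.
  apply: eq_integral => w _; rewrite /V big_ord_recr/= -/(V i w) sumEFin.
  congr EFin; rewrite (bigD1 (M i w))//= big1 ?addr0.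
    by rewrite indicE mem_set// mulr1.
  move=> j jM; rewrite indicE memNset ?mulr0//= => /esym e.
  by rewrite e eqxx in jM.
have mVY j : gmeasurable (G i) (fun w => V i w * Y i j w).
  by apply: gmeasurableM; [exact: mV|exact: mY].
rewrite ge0_integral_sum//; last 2 first.
- move=> j; apply/measurable_EFinP/measurable_funM; first exact: toO.
  exact: measurable_indic.
- by move=> j w _; rewrite lee_fin !mulr_ge0 ?V0 ?Y0.
have -> : (\sum_j \int[P]_w (V i w * Y i j w * \1_(M i @^-1` [set j]) w)%:E =
   \sum_j \int[P]_w (V i w * Y i j w * p i j w)%:E)%E.
  apply: eq_bigr => j _.
  apply: (@integral_sample _ _ _ P (G i)) => //.
  - exact: sG.
  - exact: mG.
  - exact: mp.
  - by move=> w; exact: p0.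
  - by move=> E; exact: PM.
  - by move=> w; rewrite mulr_ge0 ?V0 ?Y0.
rewrite -ge0_integral_sum//; last 2 first.
- move=> j; apply/measurable_EFinP;
    apply: measurable_funM; [exact: toO|apply: toO; exact: mp].
- by move=> j w _; rewrite lee_fin !mulr_ge0 ?V0 ?Y0 ?p0.
apply: (@le_trans _ _ (\int[P]_w (q%:E * (V i w)%:E))%E).
  apply: ge0_le_integral => //.
  - by move=> w _; apply: sume_ge0 => j _; rewrite lee_fin !mulr_ge0 ?V0 ?Y0 ?p0.
  - apply: emeasurable_sum => j.
    by apply/measurable_EFinP;
    apply: measurable_funM; [exact: toO|apply: toO; exact: mp].
  - apply/measurable_EFinP/measurable_funM; first exact: measurable_cst.
    exact: VO.
  - move=> w _; rewrite sumEFin -EFinM lee_fin mulrC.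
    under eq_bigr do rewrite -mulrA.
    rewrite -mulr_sumr ler_wpM2l ?V0//.
    by under eq_bigr do rewrite mulrC; exact: pY.
have -> : (\int[P]_w (q%:E * (V i w)%:E) = q%:E * \int[P]_w (V i w)%:E)%E.
  rewrite ge0_integralZl//.
  - by apply/measurable_EFinP; exact: VO.
  - by move=> w _; rewrite lee_fin V0.
by rewrite exprS EFinM lee_wpmul2l ?lee_fin ?IH.
Qed.

(** Markov's inequality for the product. With exponential factors it becomes the Chernoff bound
    behind both rare events. *)
Lemma sampled_prod_tail (x : R) : 0 < x ->
  (P [set w | (x <= \prod_(l < T) Y l (M l w) w)%R] <= (q ^+ T / x)%:E)%E.
Proof.
move=> x0; rewrite -/(V T).
have mA : measurable [set w | x <= V T w].
  rewrite (_ : [set w | _] = V T @^-1` [set` `[x, +oo[]); last first.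
    by apply/seteqP; split => w /=; rewrite in_itv/= andbT.
  by rewrite -[X in measurable X]setTI; apply: VO.
rewrite EFinM lee_pdivlMr//.
apply: le_trans (integral_sampled_prod (leqnn T)).
have -> : (P [set w | (x <= V T w)%R] * x%:E =
   \int[P]_w (x * \1_[set w | x <= V T w] w)%:E)%E.
  under eq_integral do rewrite EFinM.
  rewrite ge0_integralZl//.
  - by rewrite integral_indic// setIT muleC.
  - by apply/measurable_EFinP/measurable_indic.
  - by rewrite lee_fin ltW.
apply: ge0_le_integral => //.
- by move=> w _; rewrite lee_fin mulr_ge0// ltW.
- apply/measurable_EFinP/measurable_funM; first exact: measurable_cst.
  exact: measurable_indic.
- by apply/measurable_EFinP/VO.
- move=> w _; rewrite lee_fin indicE; have [|_] := boolP (w \in _).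
    by rewrite inE /= mulr1.
  by rewrite mulr0 V0.
Qed.

End sampled_product.

(** * Elementary inequalities for exponentials, logarithms and powers *)

Section exponential_inequalities.
Context {R : realType}.
Implicit Types y : R.

(** Multiply by [expR y >= 1 + y] and use [(1 - y + y^2)(1 + y) = 1 + y^3 >= 1]. *)
Lemma expRN_le_quadratic y : 0 <= y -> expR (- y) <= 1 - y + y ^+ 2.
Proof.
move=> y0; rewrite expRN -[leLHS]mul1r ler_pdivrMr ?expR_gt0//.
apply: (@le_trans _ _ ((1 - y + y ^+ 2) * (1 + y))).
  have -> : (1 - y + y ^+ 2) * (1 + y) = 1 + y ^+ 3 by ring.
  by rewrite lerDl exprn_ge0.
rewrite ler_wpM2l ?expR_ge1Dx//.
by nra.
Qed.

Lemma expR_le_inv y : y < 1 -> expR y <= (1 - y)^-1.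
Proof.
move=> y1; rewrite -[expR y]invrK -expRN lef_pV2 ?posrE ?expR_gt0 ?subr_gt0//.
exact: expR_ge1Dx.
Qed.

Lemma expR_le_double y : 0 <= y <= 1 / 2 -> expR y <= 1 + 2 * y.
Proof.
move=> /andP[y0 y2]; apply: le_trans (expR_le_inv _) _; first by lra.
rewrite -[leLHS]mul1r ler_pdivrMr; last by lra.
by nra.
Qed.

Lemma expRN1_ge : 1 / 3 <= expR (-1) :> R.
Proof.
have -> : (-1 : R) = - (1 / 8) * 8%:R by lra.
rewrite expRM_natr; apply: (@le_trans _ _ ((7 / 8) ^+ 8)); first by lra.
have h : 7 / 8 <= expR (- (1 / 8)) :> R by apply: le_trans (expR_ge1Dx _); lra.
by apply: lerXn2r h; rewrite nnegrE ?expR_ge0//; lra.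
Qed.

(** The bound [(1 - y / n)^(-n)] on [expR y] has quadratic coefficient [(n + 1) / (2 n)]; [n = 4] is
    the first value that brings it below [2 / 3]. *)
Lemma expR_le_quadratic y : 0 <= y <= 1 / 10 -> expR y <= 1 + y + 2 / 3 * y ^+ 2.
Proof.
move=> /andP[y0 y1]; have -> : y = (y / 4) * 4%:R by field.
rewrite expRM_natr; set z := y / 4.
have z0 : 0 <= z by rewrite /z; lra.
have z1 : z <= 1 / 40 by rewrite /z; lra.
apply: (@le_trans _ _ ((1 - z)^-1 ^+ 4)).
  have h : expR z <= (1 - z)^-1 by apply: expR_le_inv; lra.
  by apply: lerXn2r h; rewrite nnegrE ?expR_ge0// invr_ge0; lra.
rewrite exprVn -[leLHS]mul1r ler_pdivrMr; last by apply: exprn_gt0; lra.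
suff : 0 <= (1 + z * 4 + 2 / 3 * (z * 4) ^+ 2) * (1 - z) ^+ 4 - 1 by lra.
have -> : (1 + z * 4 + 2 / 3 * (z * 4) ^+ 2) * (1 - z) ^+ 4 - 1 =
  z ^+ 2 * (2 / 3 - 68 / 3 * z + 49 * z ^+ 2 + z ^+ 3 * (32 / 3 * z - 116 / 3)) by field.
apply: mulr_ge0; first exact: sqr_ge0.
have z3 : 0 <= z ^+ 3 <= z ^+ 2.
  by rewrite exprn_ge0//= exprS ler_piMl ?sqr_ge0//; lra.
by nra.
Qed.

Lemma ln2_ge : 1 / 2 <= ln 2 :> R.
Proof.
rewrite -ler_expR lnK ?posrE//; apply: le_trans (expR_le_double _) _; lra.
Qed.

Lemma powR_3half y : 0 <= y -> y `^ (3 / 2) = Num.sqrt y ^+ 3.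
Proof.
move=> y0; rewrite -powR12_sqrt// -powR_mulrn ?powR_ge0// -powRrM.
by congr (_ `^ _); field.
Qed.

End exponential_inequalities.

(** * The tuning parameters, the threshold and the weights *)

Section parameters.
Context {R : realType} (K T : nat).
Hypotheses (K2 : (2 <= K)%N) (T1 : (1 <= T)%N).
Local Notation eta := (eta R K T).
Local Notation theta := (theta R K T).

Lemma natK_ge2 : 2 <= K%:R :> R. Proof. by rewrite ler_nat. Qed.
Lemma natT_ge1 : 1 <= T%:R :> R. Proof. by rewrite ler1n. Qed.

Lemma lnK_ge : 1 / 2 <= ln K%:R :> R.
Proof.
apply: le_trans ln2_ge _; rewrite ler_ln ?posrE ?natK_ge2//.
by apply: lt_le_trans natK_ge2.
Qed.

Let K0 : 0 < K%:R :> R. Proof. exact: lt_le_trans natK_ge2. Qed.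
Let T0 : 0 < T%:R :> R. Proof. exact: lt_le_trans natT_ge1. Qed.
Let L0 : 0 < ln K%:R :> R. Proof. by apply: lt_le_trans lnK_ge; lra. Qed.

Lemma eta_gt0 : 0 < eta.
Proof. by rewrite sqrtr_gt0 divr_gt0// mulr_gt0. Qed.

Lemma theta_gt0 : 0 < theta.
Proof. by rewrite sqrtr_gt0 !mulr_gt0. Qed.

Lemma eta_theta : eta * theta = ln K%:R.
Proof.
rewrite /Defs.eta /Defs.theta -sqrtrM ?divr_ge0 ?mulr_ge0 ?ltW//.
have -> : ln K%:R / (T%:R * K%:R) * (K%:R * T%:R * ln K%:R) = ln K%:R ^+ 2 :> R.
  by field; rewrite !gt_eqF.
by rewrite sqrtr_sqr gtr0_norm.
Qed.

Lemma theta_sqr : theta ^+ 2 = K%:R * T%:R * ln K%:R.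
Proof. by rewrite sqr_sqrtr// !mulr_ge0 ?ltW. Qed.

Lemma eta_KT : eta * (K%:R * T%:R) = theta.
Proof.
apply: (mulIf (x := theta)); first by rewrite gt_eqF ?theta_gt0.
rewrite mulrAC eta_theta -expr2 theta_sqr; ring.
Qed.

End parameters.

Section threshold.
Context {R : realType} (K T : nat).
Hypotheses (K2 : (2 <= K)%N) (T1 : (1 <= T)%N).
Local Notation eta := (eta R K T).
Local Notation theta := (theta R K T).
Local Notation g := (@threshold R K T).
Let K0 : 0 < K%:R :> R. Proof. by rewrite ltr0n; exact: leq_trans K2. Qed.
Let theta0 : 0 < theta. Proof. exact: theta_gt0. Qed.

Lemma threshold_ge_eta x : eta <= g x.
Proof. by rewrite /threshold le_max lexx. Qed.

Lemma thresholdE x : 0 <= x ->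
  g x = Num.max eta (1 / (K%:R * Num.sqrt (1 + x / theta) ^+ 3)).
Proof. by move=> x0; rewrite /threshold powR_3half// addr_ge0// divr_ge0// ltW. Qed.

Let u_ge1 x : 0 <= x -> 1 <= Num.sqrt (1 + x / theta).
Proof.
by move=> x0; rewrite -[leLHS]sqrtr1 ler_wsqrtr// lerDl divr_ge0// ltW.
Qed.

Let Ku_gt0 x : 0 <= x -> 0 < K%:R * Num.sqrt (1 + x / theta) ^+ 3.
Proof.
by move=> x0; rewrite mulr_gt0// exprn_gt0//; apply: lt_le_trans (u_ge1 x0).
Qed.

Lemma threshold_homo x y : 0 <= x -> x <= y -> g y <= g x.
Proof.
move=> x0 xy; have y0 := le_trans x0 xy; rewrite !thresholdE//.
rewrite ge_max le_max lexx/= le_max; apply/orP; right.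
rewrite ler_pM2l// lef_pV2 ?posrE ?Ku_gt0// ler_pM2l//.
rewrite lerXn2r ?nnegrE ?sqrtr_ge0// ler_wsqrtr// lerD2l ler_pM2r ?invr_gt0//.
Qed.

Lemma invr_threshold_le x : 0 <= x ->
  (g x)^-1 <= K%:R * Num.sqrt (1 + x / theta) ^+ 3.
Proof.
move=> x0; rewrite -[leRHS]invrK lef_pV2 ?posrE ?invr_gt0 ?Ku_gt0//; last first.
  by apply: lt_le_trans (threshold_ge_eta x); exact: eta_gt0.
by rewrite thresholdE// le_max div1r lexx orbT.
Qed.

(** Since [eta * theta] is [ln K], the hypothesis [small] amounts to [eta <= 1 / K]; the uniform
    initial weights then reach the threshold. *)
Lemma threshold0_le (small : K%:R * ln K%:R <= theta) : g 0 <= K%:R^-1.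
Proof.
rewrite thresholdE// mul0r addr0 sqrtr1 expr1n mulr1 div1r ge_max lexx andbT.
by rewrite -(ler_pM2r theta0) eta_theta// ler_pdivlMl.
Qed.

End threshold.

Section weights.
Context {R : realType} (K T : nat).
Implicit Types z : 'rV[R]_K.
Local Notation eta := (eta R K T).

Lemma weight_sum_gt0 z : (0 < K)%N -> 0 < \sum_(l < K) expR (- eta * z 0 l).
Proof.
case: K z => [//|k] z _; rewrite big_ord_recl ltr_wpDr ?expR_gt0//.
by apply: sumr_ge0 => l _; exact: expR_ge0.
Qed.

Lemma weightsE z j : weights T z 0 j =
  expR (- eta * z 0 j) / \sum_(l < K) expR (- eta * z 0 l).
Proof. by rewrite mxE. Qed.

Lemma weights_gt0 z j : 0 < weights T z 0 j.
Proof.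
by rewrite weightsE divr_gt0 ?expR_gt0 ?weight_sum_gt0//; case: (K) j => [[]|].
Qed.

Lemma weights_sum z : (0 < K)%N -> \sum_j weights T z 0 j = 1.
Proof.
move=> K0; under eq_bigr do rewrite weightsE.
by rewrite -mulr_suml divff// gt_eqF// weight_sum_gt0.
Qed.

Lemma weights0 j : weights T (0 : 'rV[R]_K) 0 j = K%:R^-1.
Proof.
rewrite weightsE; under eq_bigr do rewrite mxE mulr0 expR0.
by rewrite mxE mulr0 expR0 sumr_const card_ord div1r.
Qed.

(** The exponential is exactly the change of the numerator, while the normalising sum can only
    decrease. *)
Lemma weights_le z z' j : 0 <= eta -> (forall l, z 0 l <= z' 0 l) ->
  weights T z 0 j * expR (- eta * (z' 0 j - z 0 j)) <= weights T z' 0 j.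
Proof.
move=> eta0 zz'; have K0 : (0 < K)%N by case: (K) j => [[]|].
rewrite !weightsE mulrAC -expRD -mulrDr [z 0 j + _]addrC subrK.
rewrite ler_wpM2l ?expR_ge0// lef_pV2 ?posrE ?weight_sum_gt0//.
by apply: ler_sum => l _; rewrite ler_expR !mulNr lerN2 ler_wpM2l.
Qed.

End weights.

(** * Deterministic cost bounds along a single path *)

(** Used with [k = K], [t = theta] and with [u], [v] the values of [sqrt (1 + A / theta)] before and
    after a charge. Without the factor 3, the two sides differ by the factor [(v + u) v / u^2],
    which is at most 3 once [v <= 6/5 u]. *)
Lemma sqrt_potential_drop {R : realFieldType} (k t u v : R) :
  0 < k -> 0 < t -> 35 * k <= t -> 1 <= u -> u <= v ->
  k * u ^+ 3 <= 2 * t -> t * (v ^+ 2 - u ^+ 2) <= 3 * (k * u ^+ 3) ->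
  t * (v ^+ 2 - u ^+ 2) / (k * u ^+ 3) <= 3 * (t / k) * (u^-1 - v^-1).
Proof.
move=> k0 t0 kt u1 uv ku3 vu.
(* Otherwise the cube of [k u] would exceed [t^3 / 512], although it is [k u^3] times [k^2], hence
   at most [2 t (t / 35)^2 = 2 t^3 / 1225]. *)
have ku : k * u <= 1 / 8 * t.
  rewrite leNgt; apply/negP => ktu.
  have : (1 / 8 * t) ^+ 3 < (k * u) ^+ 3.
    by rewrite ltrXn2r ?nnegrE//; apply: mulr_ge0; lra.
  have : (k * u) ^+ 3 <= 2 * t * (t / 35) ^+ 2.
    have -> : (k * u) ^+ 3 = k * u ^+ 3 * k ^+ 2 by ring.
    apply: ler_pM => //; first by rewrite mulr_ge0 ?exprn_ge0//; lra.
      exact: sqr_ge0.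
    by rewrite lerXn2r ?nnegrE//; lra.
  have : 0 < t ^+ 3 by rewrite exprn_gt0.
  have -> : 2 * t * (t / 35) ^+ 2 = 2 / 1225 * t ^+ 3 by field.
  have -> : (1 / 8 * t) ^+ 3 = 1 / 512 * t ^+ 3 by field.
  by lra.
have v12 : v <= 6 / 5 * u.
  have : t * (v ^+ 2 - u ^+ 2) <= t * (3 / 8 * u ^+ 2).
    apply: le_trans vu _.
    have -> : 3 * (k * u ^+ 3) = k * u * (3 * u ^+ 2) by ring.
    have -> : t * (3 / 8 * u ^+ 2) = 1 / 8 * t * (3 * u ^+ 2) by field.
    by rewrite ler_wpM2r// mulr_ge0 ?sqr_ge0.
  rewrite ler_pM2l// => v2; rewrite leNgt; apply/negP => uv12.
  by nra.
have u0 : 0 < u by lra.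
have v0 : 0 < v by lra.
have -> : t * (v ^+ 2 - u ^+ 2) / (k * u ^+ 3) =
    t / k * (u^-1 - v^-1) * ((v + u) * v / u ^+ 2).
  by field; rewrite !gt_eqF.
rewrite -[leRHS]mulrA [leRHS]mulrC ler_wpM2l//.
  by rewrite mulr_ge0 ?subr_ge0 ?lef_pV2// divr_ge0 ?ltW.
by rewrite ler_pdivrMr ?exprn_gt0//; nra.
Qed.

Lemma sum_delta {R : pzSemiRingType} {I : finType} (k : I) (e : R) :
  \sum_j (j == k)%:R * e = e.
Proof.
by rewrite (bigD1 k)//= eqxx mul1r big1 ?addr0// => j /negPf ->; rewrite mul0r.
Qed.

Section path.
Context {R : realType} (K T : nat) (m : nat -> 'I_K) (x : nat -> R).
Hypotheses (K2 : (2 <= K)%N) (T1 : (1 <= T)%N).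
Hypothesis x01 : forall i, (i < T)%N -> 0 <= x i <= 1.
Local Notation eta := (eta R K T).
Local Notation theta := (theta R K T).
Local Notation g := (@threshold R K T).

Definition chat i j := (accounts_state T m x i).1 0 j.
Definition acct i j := (accounts_state T m x i).2 0 j.
Local Notation p i j := (accounts_prob T m x i 0 j).
Definition trusted i := g (acct i (m i)) <= p i (m i).
(** The importance-weighted estimator: [(j == m i)%:R * estimate i] estimates the cost of arm [j]
    without bias when the arm is drawn from the weights. *)
Definition estimate i := x i / p i (m i).

Let K0 : (0 < K)%N. Proof. exact: leq_trans K2. Qed.
Let KR0 : 0 < K%:R :> R. Proof. by rewrite ltr0n. Qed.
Let eta0 : 0 < eta. Proof. exact: eta_gt0. Qed.
Let theta0 : 0 < theta. Proof. exact: theta_gt0. Qed.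

Lemma chat0 j : chat 0 j = 0. Proof. by rewrite /chat mxE. Qed.
Lemma acct0 j : acct 0 j = 0. Proof. by rewrite /acct mxE. Qed.

Lemma chatS i j : chat i.+1 j =
  chat i j + (if trusted i then (j == m i)%:R * estimate i else 0).
Proof.
rewrite /chat /= /accounts_step -/(accounts_prob T m x i) -/(trusted i).
case: ifP => _ /=; rewrite ?addr0//.
by rewrite mxE [in LHS](mxE _ _ 0 j) [X in _ * X]mxE eqxx mulrC.
Qed.

Lemma acctS i j : acct i.+1 j =
  acct i j + (if trusted i then 0 else (j == m i)%:R * estimate i).
Proof.
rewrite /acct /= /accounts_step -/(accounts_prob T m x i) -/(trusted i).
case: ifP => _ /=; rewrite ?addr0//.
by rewrite mxE [in LHS](mxE _ _ 0 j) [X in _ * X]mxE eqxx mulrC.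
Qed.

Lemma prob_gt0 i j : 0 < p i j. Proof. exact: weights_gt0. Qed.

Lemma estimate_ge0 i : (i < T)%N -> 0 <= estimate i.
Proof. by move=> /x01/andP[? _]; rewrite divr_ge0// ltW// prob_gt0. Qed.

Lemma estimateK i : p i (m i) * estimate i = x i.
Proof. by rewrite /estimate mulrC mulfVK// gt_eqF// prob_gt0. Qed.

Lemma chat_le i j : (i < T)%N -> chat i j <= chat i.+1 j.
Proof.
move=> iT; rewrite chatS lerDl; case: ifP => // _.
by rewrite mulr_ge0// estimate_ge0.
Qed.

Lemma acct_le i j : (i < T)%N -> acct i j <= acct i.+1 j.
Proof.
move=> iT; rewrite acctS lerDl; case: ifP => // _.
by rewrite mulr_ge0// estimate_ge0.
Qed.

Lemma acct_ge0 i j : (i <= T)%N -> 0 <= acct i j.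
Proof.
elim: i => [|i IH] iT; first by rewrite acct0.
by apply: le_trans (acct_le j iT); exact/IH/ltnW.
Qed.

Lemma acct_homo i i' j : (i <= i')%N -> (i' <= T)%N -> acct i j <= acct i' j.
Proof.
elim: i' => [|i' IH]; first by rewrite leqn0 => /eqP ->.
rewrite leq_eqVlt => /orP[/eqP -> //|ii' i'T].
exact: le_trans (IH ii' (ltnW i'T)) (acct_le j i'T).
Qed.

Lemma chat_acctE i j : chat i j + acct i j =
  \sum_(l < i) (j == m l)%:R * estimate l.
Proof.
elim: i => [|i IH]; first by rewrite chat0 acct0 addr0 big_ord0.
rewrite big_ord_recr/= -IH chatS acctS.
by case: ifP => _; rewrite addr0 ?addrA// addrAC.
Qed.

Lemma sum_chat_acct i :
  \sum_j chat i j + \sum_j acct i j = \sum_(l < i) estimate l.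
Proof.
rewrite -big_split/=; under eq_bigr do rewrite chat_acctE.
by rewrite exchange_big/=; apply: eq_bigr => l _; exact: sum_delta.
Qed.

(* [p i j] only drops in rounds where it is at least the threshold, and then
   by a factor at most e, while the threshold never increases. *)
Lemma threshold_le_prob i j : K%:R * ln K%:R <= theta -> (i <= T)%N ->
  g (acct i j) <= 3 * p i j.
Proof.
move=> small; elim: i => [_|i IH iT].
  rewrite acct0 /accounts_prob weights0; apply: le_trans (threshold0_le K2 T1 small) _.
  by rewrite -[leLHS]mul1r ler_wpM2r//; lra.
have iT' := ltnW iT.
have pS : p i j * expR (- eta * (chat i.+1 j - chat i j)) <= p i.+1 j.
  by apply: weights_le => [|l]; [exact: ltW|exact: chat_le].
have ga : g (acct i.+1 j) <= g (acct i j).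
  by apply: threshold_homo => //; [exact: acct_ge0|exact: acct_le].
move: pS; rewrite chatS; case: ifPn => [good|_]; last first.
  rewrite addr0 subrr mulr0 expR0 mulr1 => pS.
  by apply: le_trans ga (le_trans (IH iT') _); lra.
have [->|_] := eqVneq j (m i); last first.
  rewrite mul0r addr0 subrr mulr0 expR0 mulr1 => pS.
  by apply: le_trans ga (le_trans (IH iT') _); lra.
rewrite mul1r addrC addKr => pS; apply: le_trans (_ : p i (m i) <= _).
  apply: le_trans good; apply: threshold_homo => //; first exact: acct_ge0.
  exact: acct_le.
have pm0 := prob_gt0 i (m i).
have e1 : eta * estimate i <= 1.
  have := threshold_ge_eta K T (acct i (m i)) => /le_trans/(_ good) ep.
  rewrite /estimate mulrA ler_pdivrMr// mul1r; apply: le_trans ep.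
  by rewrite ler_piMr ?(ltW eta0)//; case/andP: (x01 iT).
have : 1 / 3 <= expR (- eta * estimate i).
  by apply: le_trans expRN1_ge _; rewrite ler_expR mulNr lerN2.
move: pS; set e := expR _ => pS e3.
by nra.
Qed.

Lemma invr_prob_le i j : K%:R * ln K%:R <= theta -> (i <= T)%N ->
  (p i j)^-1 <= 3 / g (acct i j).
Proof.
move=> small iT; have g0 : 0 < g (acct i j).
  by apply: lt_le_trans (threshold_ge_eta _ _ _).
rewrite -[leLHS]mul1r ler_pdivrMr ?prob_gt0// mulrAC ler_pdivlMr// mul1r.
exact: threshold_le_prob.
Qed.

(** A trusted round multiplies the sum by [1 - p (1 - exp (- eta e))], with [e] the estimate and
    [p e = x]. The quadratic bound on the exponential gives the linear term [eta x] and an error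
    [eta^2 x e <= eta^2 e], and these errors add up to [eta^2] times the sum of [chat]. *)
Lemma exp_weight_potential i : (i <= T)%N ->
  \sum_j expR (- eta * chat i j) <= K%:R *
    expR (- eta * (\sum_(l < i) if trusted l then x l else 0) +
          eta ^+ 2 * \sum_j chat i j).
Proof.
elim: i => [_|i IH iT].
  rewrite big_ord0 [X in _ + _ * X]big1 => [|j _]; last exact: chat0.
  rewrite !mulr0 addr0 expR0 mulr1.
  by under eq_bigr do rewrite chat0 mulr0 expR0; rewrite sumr_const card_ord.
have {}IH := IH (ltnW iT); rewrite big_ord_recr/=.
case: ifPn => [good|bad]; last first.
  have -> : chat i.+1 = chat i.
    by apply/funext => j; rewrite chatS (negbTE bad) addr0.
  by rewrite addr0.
have -> : \sum_j chat i.+1 j = \sum_j chat i j + estimate i.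
  under eq_bigr do rewrite chatS good.
  by rewrite big_split/= sum_delta.
set W := \sum_j expR _ in IH.
have W0 : 0 < W by exact: (weight_sum_gt0 T (accounts_state T m x i).1 K0).
have pW : p i (m i) * W = expR (- eta * chat i (m i)).
  by rewrite /accounts_prob weightsE mulfVK ?gt_eqF.
have -> : \sum_j expR (- eta * chat i.+1 j) =
    W * (1 - p i (m i) * (1 - expR (- (eta * estimate i)))).
  have -> : W * (1 - p i (m i) * (1 - expR (- (eta * estimate i)))) =
    W - p i (m i) * W + p i (m i) * W * expR (- (eta * estimate i)) by ring.
  rewrite pW /W (bigD1 (m i))//= [in RHS](bigD1 (m i))//= [X in X - _]addrC addrK.
  rewrite [LHS]addrC -expRD chatS good eqxx mul1r mulrDr mulNr; congr (_ + _).
    by apply: eq_bigr => j /negPf jm; rewrite chatS good jm mul0r addr0.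
  by rewrite !mulNr.
rewrite [X in _ <= _ * expR X](_ : _ =
    - eta * (\sum_(l < i) if trusted l then x l else 0) +
    eta ^+ 2 * (\sum_j chat i j) +
    (- (eta * x i) + eta ^+ 2 * estimate i)); last by ring.
rewrite expRD mulrA; apply: ler_pM => //; first exact: ltW.
  have e1 : expR (- (eta * estimate i)) <= 1.
    by rewrite expR_le1 oppr_le0 mulr_ge0 ?estimate_ge0// ltW.
  have p1 : p i (m i) <= 1.
    have := weights_sum T (accounts_state T m x i).1 K0.
    rewrite (bigD1 (m i))//= => <-; rewrite lerDl.
    by apply: sumr_ge0 => j _; rewrite ltW// weights_gt0.
  rewrite subr_ge0; apply: mulr_ile1 => //; first exact/ltW/prob_gt0.
    by rewrite subr_ge0.
apply: le_trans (expR_ge1Dx _).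
have e0 := estimate_ge0 iT.
have := expRN_le_quadratic (mulr_ge0 (ltW eta0) e0).
have := x01 iT; have := estimateK i; have := prob_gt0 i (m i).
set e := expR _ => p0 pe /andP[x0 x1] ee.
have : p i (m i) * (1 - e) >= eta * x i - eta ^+ 2 * (x i * estimate i).
  rewrite -pe (_ : eta * _ - _ = p i (m i) *
    (eta * estimate i - (eta * estimate i) ^+ 2)); last by ring.
  by rewrite ler_pM2l//; lra.
have : eta ^+ 2 * (x i * estimate i) <= eta ^+ 2 * estimate i.
  by rewrite ler_wpM2l ?sqr_ge0// ler_piMl.
by lra.
Qed.

(** Keep only the term of arm [j] in the potential, take logarithms and divide by [eta]; the initial
    value [ln K] becomes [theta]. *)
Lemma trusted_cost_le j : \sum_(l < T) (if trusted l then x l else 0) <=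
  chat T j + theta + eta * \sum_j chat T j.
Proof.
have h : expR (- eta * chat T j) <= \sum_j expR (- eta * chat T j).
  rewrite (bigD1 j)//= lerDl; apply: sumr_ge0 => l _; exact: expR_ge0.
have {h} := le_trans h (exp_weight_potential (leqnn T)).
have lnKE : K%:R = expR (ln K%:R) :> R by rewrite lnK ?posrE.
rewrite [X in _ <= X * _]lnKE -expRD ler_expR -(eta_theta K2 T1) => h.
by rewrite -(ler_pM2l eta0); lra.
Qed.

(** An untrusted round has [x = p e < g(A) e] unless [e = 0]. If the maximum defining [g] is [eta],
    the first term suffices; otherwise [g(A) = 1 / (K u^3)] and the drop of the potential pays. *)
Lemma untrusted_cost_step i : 71 * (K%:R * ln K%:R) <= theta -> (i < T)%N ->
  ~~ trusted i ->
  x i <= eta * estimate i + 3 * (theta / K%:R) *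
    ((Num.sqrt (1 + acct i (m i) / theta))^-1 -
     (Num.sqrt (1 + acct i.+1 (m i) / theta))^-1).
Proof.
move=> small iT bad.
have L2 : 1 / 2 <= ln K%:R :> R by exact: lnK_ge.
have KL0 : 0 <= K%:R * ln K%:R :> R by rewrite mulr_ge0//; lra.
have KL : K%:R * ln K%:R <= theta by lra.
have a0 := acct_ge0 (m i) (ltnW iT).
have e0 := estimate_ge0 iT.
have aS : acct i.+1 (m i) = acct i (m i) + estimate i.
  by rewrite acctS (negbTE bad) eqxx mul1r.
rewrite aS; set a := acct i (m i) in a0 *; set e := estimate i in e0 *.
set u := Num.sqrt _; set v := Num.sqrt _.
have u1 : 1 <= u.
  by rewrite -[leLHS]sqrtr1 ler_wsqrtr// lerDl divr_ge0// ltW.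
have uv : u <= v.
  by rewrite ler_wsqrtr// lerD2l ler_pM2r ?invr_gt0// lerDl.
have u0 : 0 < u by lra.
have v0 : 0 < v by lra.
have u2 : u ^+ 2 = 1 + a / theta by rewrite sqr_sqrtr// addr_ge0// divr_ge0// ltW.
have v2 : v ^+ 2 = 1 + (a + e) / theta.
  by rewrite sqr_sqrtr// addr_ge0// divr_ge0 ?addr_ge0// ltW.
have eE : theta * (v ^+ 2 - u ^+ 2) = e.
  by rewrite u2 v2; field; rewrite gt_eqF.
have drop0 : 0 <= 3 * (theta / K%:R) * (u^-1 - v^-1).
  by rewrite !mulr_ge0 ?ler0n ?invr_ge0 ?subr_ge0 ?lef_pV2// ltW.
have px : x i <= g a * e.
  rewrite -estimateK ler_wpM2r// ltW// ltNge.
  exact: bad.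
have ga := thresholdE K2 T1 a0; rewrite -/u in ga.
have Ku0 : 0 < K%:R * u ^+ 3 by rewrite mulr_gt0// exprn_gt0.
have [geta|etag] := leP (1 / (K%:R * u ^+ 3)) eta.
  apply: le_trans px _; rewrite ga (max_idPl geta).
  by rewrite lerDl.
rewrite (max_idPr (ltW etag)) in ga.
apply: le_trans px _; rewrite ga.
apply: (@le_trans _ _ (3 * (theta / K%:R) * (u^-1 - v^-1))); last first.
  by rewrite lerDr mulr_ge0// ltW.
rewrite div1r [_^-1 * e]mulrC -eE; apply: sqrt_potential_drop => //.
(* The three side conditions: [35 K <= theta] follows from the factor 71 and [ln K >= 1/2];
   [K u^3 <= 2 theta] from [eta < 1 / (K u^3)]; and the estimate is at most [1 / p <= 3 / g(A)]. *)
- by nra.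
- have : eta * (K%:R * u ^+ 3) <= 1 by rewrite -ler_pdivlMr// ltW.
  rewrite -(ler_pM2r theta0) mulrAC eta_theta// mul1r; nra.
rewrite eE; have : (p i (m i))^-1 <= 3 / g a := invr_prob_le _ KL (ltnW iT).
rewrite ga div1r invrK; apply: le_trans.
rewrite /e /estimate -[leRHS]mul1r ler_wpM2r ?invr_ge0 ?(ltW (prob_gt0 _ _))//.
by case/andP: (x01 iT).
Qed.

Lemma untrusted_cost_le : 71 * (K%:R * ln K%:R) <= theta ->
  \sum_(l < T) (if trusted l then 0 else x l) <=
  3 * theta + eta * \sum_j acct T j.
Proof.
move=> small.
pose phi a := (Num.sqrt (1 + a / theta))^-1.
have phi0 : phi 0 = 1 by rewrite /phi mul0r addr0 sqrtr1 invr1.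
(* The sum of the [1 - phi] terms starts at 0 and never exceeds [K], so the telescoped drops cost at
   most [3 * theta]. *)
have main i : (i <= T)%N -> \sum_(l < i) (if trusted l then 0 else x l) <=
    eta * \sum_j acct i j +
    3 * (theta / K%:R) * \sum_j (1 - phi (acct i j)).
  elim: i => [_|i IH iT].
    rewrite big_ord0 (eq_bigr (fun=> 0)) ?big1_eq; last by move=> j _; rewrite acct0.
    rewrite mulr0 add0r (eq_bigr (fun=> 0)) ?big1_eq ?mulr0//.
    by move=> j _; rewrite acct0 phi0 subrr.
  have {}IH := IH (ltnW iT); rewrite big_ord_recr/=.
  case: ifPn => [good|bad].
    have -> : acct i.+1 = acct i by apply/funext => j; rewrite acctS good addr0.
    by rewrite addr0.
  apply: le_trans (lerD IH (untrusted_cost_step small iT bad)) _.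
  rewrite -/(phi _) -/(phi _).
  rewrite (bigD1 (m i))//= (bigD1 (m i) (F := fun j => 1 - phi (acct i j)))//=.
  rewrite [in leRHS](bigD1 (m i))//= [X in _ <= _ + _ * X](bigD1 (m i))//=.
  have same j : j != m i -> acct i.+1 j = acct i j.
    by move=> /negPf jm; rewrite acctS (negbTE bad) jm mul0r addr0.
  rewrite [X in _ <= eta * (_ + X) + _](eq_bigr (acct i)); last first.
    by move=> j; exact: same.
  rewrite [X in _ <= _ + _ * (_ + X)](eq_bigr (fun j => 1 - phi (acct i j))); last first.
    by move=> j jm; rewrite same.
  have -> : acct i.+1 (m i) = acct i (m i) + estimate i.
    by rewrite acctS (negbTE bad) eqxx mul1r.
  by rewrite le_eqVlt; apply/orP; left; apply/eqP; ring.
apply: le_trans (main T (leqnn T)) _; rewrite addrC lerD2r.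
have : \sum_j (1 - phi (acct T j)) <= K%:R.
  rewrite -[K in K%:R]card_ord -sumr_const; apply: ler_sum => j _.
  by rewrite gerBl invr_ge0 sqrtr_ge0.
rewrite -(ler_pM2l (_ : 0 < 3 * (theta / K%:R))); last by rewrite mulr_gt0// divr_gt0.
by move=> h; apply: le_trans h _; rewrite -mulrA mulfVK ?gt_eqF.
Qed.

Lemma total_cost_le j : 71 * (K%:R * ln K%:R) <= theta ->
  \sum_(l < T) x l <= chat T j + 4 * theta + eta * \sum_(l < T) estimate l.
Proof.
move=> small; rewrite -sum_chat_acct mulrDr.
have -> : \sum_(l < T) x l = \sum_(l < T) (if trusted l then x l else 0) +
    \sum_(l < T) (if trusted l then 0 else x l).
  by rewrite -big_split/=; apply: eq_bigr => l _; case: ifP; rewrite ?addr0 ?add0r.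
have := trusted_cost_le j; have := untrusted_cost_le small; lra.
Qed.

End path.

(** * Measurability tools and the union bound *)

(** Inversion is the power with exponent -1 on nonnegative reals, including 0, where both take the
    value 0. *)
Lemma measurable_fun_posV (d : measure_display) (S : measurableType d)
    (R : realType) (f : S -> R) :
  (forall w, 0 <= f w) -> measurable_fun setT f ->
  measurable_fun setT (fun w => (f w)^-1).
Proof.
move=> f0 mf; rewrite (_ : (fun w => _) = (@powR R ^~ (-1)) \o f); last first.
  by apply/funext => w /=; rewrite powR_inv1.
exact: measurableT_comp (measurable_powR _) mf.
Qed.

Lemma measurable_ge_fun (d : measure_display) (S : measurableType d)
    (R : realType) (f : S -> R) (a : R) :
  measurable_fun setT f -> measurable [set w | a <= f w].
Proof.
move=> mf; rewrite (_ : [set w | _] = f @^-1` [set` `[a, +oo[]); last first.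
  by apply/seteqP; split => w /=; rewrite in_itv/= andbT.
by rewrite -[X in measurable X]setTI; exact: mf.
Qed.

Lemma measurable_le_fun (d : measure_display) (S : measurableType d)
    (R : realType) (f : S -> R) (a : R) :
  measurable_fun setT f -> measurable [set w | f w <= a].
Proof.
move=> mf; rewrite (_ : [set w | _] = f @^-1` [set` `]-oo, a]]); last first.
  by apply/seteqP; split => w /=; rewrite in_itv.
by rewrite -[X in measurable X]setTI; exact: mf.
Qed.

Lemma measure_cover_le (d : measure_display) (S : measurableType d)
    (R : realType) (mu : {measure set S -> \bar R}) (I : finType) (A : set S)
    (B : I -> set S) (u : I -> R) :
  measurable A -> (forall i, measurable (B i)) ->
  (forall w, A w -> exists i, B i w) -> (forall i, mu (B i) <= (u i)%:E)%E ->
  (mu A <= (\sum_i u i)%:E)%E.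
Proof.
move=> mA mB AB muB.
apply: (@le_trans _ _ (mu (\big[setU/set0]_i B i))).
  apply: le_measure; rewrite ?inE//; first exact: bigsetU_measurable.
  move=> w /AB[i Bi]; rewrite -bigcup_seq; exists i => //=.
  exact: mem_index_enum.
elim: (index_enum I) => [|i r IH]; first by rewrite !big_nil measure0.
rewrite !big_cons EFinD.
apply: (@le_trans _ _ (mu (B i) + mu (\big[setU/set0]_(j <- r) B j))%E).
  by apply: measureU2 => //; exact: bigsetU_measurable.
exact: leeD.
Qed.

(** * Numerical estimates for the peeling *)

(** As [exp (l / 16) >= 1 + 1/32], the ratio is at most [32 / 33]. *)
Lemma geometric_sum_le (R : realType) (l : R) (N : nat) : 1 / 2 <= l ->
  \sum_(m < N) expR (- (m%:R * l / 16)) <= 33.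
Proof.
move=> l2; set r := expR (- (l / 16)).
have r1 : r <= 32 / 33.
  rewrite /r expRN -[leLHS]mul1r ler_pdivrMr ?expR_gt0//.
  by have := expR_ge1Dx (l / 16); lra.
have r0 : 0 < r by exact: expR_gt0.
have -> : \sum_(m < N) expR (- (m%:R * l / 16)) = \sum_(m < N) r ^+ m.
  by apply: eq_bigr => m _; rewrite -expRM_natl; congr expR; ring.
have : (1 - r) * \sum_(m < N) r ^+ m <= 1.
  have := subrX1 r N; have := exprn_ge0 N (ltW r0); lra.
by move=> h; nra.
Qed.

(* With [s ^+ 2 = alpha], an account [A] lies in the m-th peel when
   [t ^+ 2 <= alpha + A / theta <= (t + 1) ^+ 2] for [t = s + m]; the exponent
   is that of the Chernoff bound at [mu = (4 * t)^-1].  It is at most [- t / 8]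
   as long as [1 + A / theta <= t ^+ 2]; otherwise [t >= s + 7] and the excess
   is absorbed by [(t - s) / 16]. *)
Lemma peel_exponent_le (R : realType) (s t : R) : 8 <= s -> s <= t ->
  2 * (4 * t)^-1 ^+ 2 * Num.sqrt (1 + ((t + 1) ^+ 2 - s ^+ 2)) ^+ 3 -
    (4 * t)^-1 * t ^+ 2 <= - ((s + t) / 16).
Proof.
move=> s8 st; have t0 : 0 < t by lra.
set v := Num.sqrt _.
have b0 : 0 <= 1 + ((t + 1) ^+ 2 - s ^+ 2).
  by nra.
have v2 : v ^+ 2 = 1 + ((t + 1) ^+ 2 - s ^+ 2) by rewrite sqr_sqrtr.
have v0 : 0 <= v by exact: sqrtr_ge0.
have -> : 2 * (4 * t)^-1 ^+ 2 * v ^+ 3 - (4 * t)^-1 * t ^+ 2 =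
    (v ^+ 3 / t ^+ 2 - 2 * t) / 8 by field; rewrite gt_eqF.
have cube a : v <= a -> v ^+ 3 / t ^+ 2 <= a ^+ 3 / t ^+ 2.
  move=> va; rewrite ler_pM2r ?invr_gt0 ?exprn_gt0// lerXn2r// nnegrE//.
  exact: le_trans va.
have [vt|tv] := leP v t.
  have := cube _ vt; have -> : t ^+ 3 / t ^+ 2 = t by field; rewrite gt_eqF.
  by lra.
have m7 : 7 + s <= t.
  have : t ^+ 2 < v ^+ 2 by rewrite ltrXn2r ?nnegrE// ltW.
  by rewrite v2 => h; nra.
have vt1 : v <= t + 1.
  rewrite -(@ler_pXn2r _ 2)// ?nnegrE; [|lra].
  by rewrite v2; nra.
have := cube _ vt1.
have -> : (t + 1) ^+ 3 / t ^+ 2 = t + 3 + 3 / t + 1 / t ^+ 2.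
  by field; rewrite gt_eqF.
have t8 : 8 <= t by lra.
have : 3 / t <= 3 / 8 by rewrite ler_pM2l// lef_pV2 ?posrE.
have : 1 / t ^+ 2 <= 1 / 8.
  by rewrite ler_pM2l// lef_pV2 ?posrE ?exprn_gt0//; nra.
by lra.
Qed.

(** * Chernoff bounds for a play of the algorithm *)

Section play.
Context (R : realType) (K T : nat) (d : measure_display)
  (Omega : measurableType d) (P : probability Omega R)
  (G : nat -> set (set Omega)) (M : nat -> Omega -> 'I_K)
  (c : nat -> 'I_K -> Omega -> R).
Hypotheses (K2 : (2 <= K)%N) (T1 : (1 <= T)%N).
Hypothesis play : accounts_play P T G M c.
Local Notation eta := (eta R K T).
Local Notation theta := (theta R K T).
Local Notation cost w := (fun l => c l (M l w) w).
Local Notation ch i j w := (chat T (M ^~ w) (cost w) i j).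
Local Notation ac i j w := (acct T (M ^~ w) (cost w) i j).
Local Notation est i w := (estimate T (M ^~ w) (cost w) i).
Local Notation p i j w := (accounts_prob T (M ^~ w) (cost w) i 0 j).

Let sG := play_sigma play.
Let mG := play_measurable play.
Let GS := play_mono play.
Let mM := play_arm play.
Let PM := play_sample play.
Let eta0 : 0 < eta. Proof. exact: eta_gt0. Qed.
Let theta0 : 0 < theta. Proof. exact: theta_gt0. Qed.
Let KR0 : 0 < K%:R :> R. Proof. by rewrite ltr0n; exact: leq_trans K2. Qed.

Lemma play_cost01 w i : (i < T)%N -> 0 <= cost w i <= 1.
Proof. by move=> iT; exact: (play_cost_bound play). Qed.

Let mc i j : (i < T)%N -> gmeasurable (G i) (c i j).
Proof.
move=> iT; apply/(gmeasurableP _ (sG (ltnW iT))) => B mB.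
exact: (play_cost play).
Qed.

Lemma gmeasurable_prob i : (forall j, gmeasurable (G i) (fun w => ch i j w)) ->
  forall j, gmeasurable (G i) (fun w => p i j w).
Proof.
move=> mch j; rewrite /gmeasurable.
have me l : measurable_fun [set: g_sigma_algebraType (G i)]
    ((fun w => expR (- eta * ch i l w)) : g_sigma_algebraType (G i) -> R).
  apply: (measurableT_comp (@measurable_expR R)).
  by apply: measurable_funM; [exact: measurable_cst|exact: mch].
rewrite (_ : (fun w => p i j w) = (fun w => expR (- eta * ch i j w) *
    (\sum_(l < K) expR (- eta * ch i l w))^-1)); last first.
  by apply/funext => w; rewrite /accounts_prob weightsE.
apply: measurable_funM; first exact: me.
apply: measurable_fun_posV.
  by move=> w; apply: sumr_ge0 => l _; exact: expR_ge0.
exact: measurable_sum.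
Qed.

(** Both vectors go through one induction, because the test that selects the vector to update reads
    both of them. *)
Lemma gmeasurable_state i j : (i <= T)%N ->
  gmeasurable (G i) (fun w => ch i j w) /\ gmeasurable (G i) (fun w => ac i j w).
Proof.
elim: i j => [j _|i IH j iT].
  split; [rewrite (_ : (fun w => _) = cst 0)|rewrite (_ : (fun w => _) = cst 0)].
  - exact: measurable_cst.
  - by apply/funext => w; rewrite chat0.
  - exact: measurable_cst.
  - by apply/funext => w; rewrite acct0.
have iT' := ltnW iT.
have mch k : gmeasurable (G i) (fun w => ch i k w) by case: (IH k iT').
have mac k : gmeasurable (G i) (fun w => ac i k w) by case: (IH k iT').
have mp := gmeasurable_prob mch.
have mest k : gmeasurable (G i) (fun w => (j == k)%:R * (c i k w / p i k w)).
  apply: measurable_funM; first exact: measurable_cst.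
  apply: measurable_funM; first exact: mc.
  by apply: measurable_fun_posV; [move=> w; exact/ltW/prob_gt0|exact: mp].
have mth k : gmeasurable (G i) (fun w => threshold K T (ac i k w)).
  rewrite /gmeasurable /threshold; apply: measurable_maxr; first exact: measurable_cst.
  apply: measurable_funM; first exact: measurable_cst.
  apply: measurable_fun_posV; first by move=> w; rewrite mulr_ge0 ?powR_ge0.
  apply: measurable_funM; first exact: measurable_cst.
  apply: (measurableT_comp (measurable_powR _)).
  apply: measurable_funD; first exact: measurable_cst.
  by apply: measurable_funM; [exact: mac|exact: measurable_cst].
have mtr k : measurable_fun [set: g_sigma_algebraType (G i)]
   ((fun w => threshold K T (ac i k w) <= p i k w) : g_sigma_algebraType (G i) -> bool).
  by apply: measurable_fun_ler; [exact: mth|exact: mp].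
have sGi := sG iT'; have sGS := sG iT.
(* The increments that would result from pulling arm [k]. They depend on information in [G i] only;
   substituting the sampled arm for [k] costs one step of the filtration. *)
pose f k w := if threshold K T (ac i k w) <= p i k w
  then (j == k)%:R * (c i k w / p i k w) else 0.
pose f' k w := if threshold K T (ac i k w) <= p i k w
  then 0 else (j == k)%:R * (c i k w / p i k w).
have mf : gmeasurable (G i.+1) (fun w => f (M i w) w).
  apply: (gmeasurable_sampled sG GS mM iT) => k.
  by apply: measurable_fun_ifT; [exact: mtr|exact: mest|exact: measurable_cst].
have mf' : gmeasurable (G i.+1) (fun w => f' (M i w) w).
  apply: (gmeasurable_sampled sG GS mM iT) => k.
  by apply: measurable_fun_ifT; [exact: mtr|exact: measurable_cst|exact: mest].
split.
- rewrite (_ : (fun w => _) = (fun w => ch i j w + f (M i w) w)).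
    by apply: measurable_funD; [exact: gmeasurable_sub (GS iT) (mch j)|exact: mf].
  by apply/funext => w; rewrite chatS.
- rewrite (_ : (fun w => _) = (fun w => ac i j w + f' (M i w) w)).
    by apply: measurable_funD; [exact: gmeasurable_sub (GS iT) (mac j)|exact: mf'].
  by apply/funext => w; rewrite acctS.
Qed.

Lemma gmeasurable_chat i j : (i <= T)%N -> gmeasurable (G i) (fun w => ch i j w).
Proof. by move=> /(gmeasurable_state j)[]. Qed.

Lemma gmeasurable_acct i j : (i <= T)%N -> gmeasurable (G i) (fun w => ac i j w).
Proof. by move=> /(gmeasurable_state j)[]. Qed.

Let mp i j : (i < T)%N -> gmeasurable (G i) (fun w => p i j w).
Proof. by move=> /ltnW iT; apply: gmeasurable_prob => k; exact: gmeasurable_chat. Qed.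

Let p_ge0 i j w : (i < T)%N -> 0 <= p i j w.
Proof. by move=> _; exact/ltW/prob_gt0. Qed.

Let sum_p i w : \sum_j p i j w = 1.
Proof. by apply: weights_sum; exact: leq_trans K2. Qed.

(** The floor [eta] in the threshold caps the importance weights; this keeps the exponents of both
    Chernoff bounds in the range where [expR] is well approximated. *)
Let eta_p i j w : K%:R * ln K%:R <= theta -> (i < T)%N -> eta * (p i j w)^-1 <= 3.
Proof.
move=> small iT; apply: (@le_trans _ _ (eta * (3 / threshold K T (ac i j w)))).
  rewrite ler_pM2l//; apply: invr_prob_le => //; last exact: ltnW.
  exact: play_cost01.
have g := threshold_ge_eta K T (ac i j w).
by rewrite mulrA ler_pdivrMr; [rewrite mulrC ler_pM2l|exact: lt_le_trans g].
Qed.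

(** Chernoff with parameter [eta / 6]: exponents are at most [1/2], so each round has conditional
    mean at most [exp (eta K / 3)]. Over [T] rounds this is [exp (theta / 3)], against the level
    [exp (theta / 2)]. *)
Lemma sum_estimate_tail : K%:R * ln K%:R <= theta ->
  (P [set w | (3 * theta <= eta * \sum_(l < T) est l w)%R] <=
   (expR (- (theta / 6)))%:E)%E.
Proof.
move=> small.
pose Y i j w := expR (eta / 6 * (c i j w / p i j w)).
have -> : [set w | 3 * theta <= eta * \sum_(l < T) est l w] =
    [set w | expR (theta / 2) <= \prod_(l < T) Y l (M l w) w].
  apply/funext => w /=; congr is_true; rewrite -expR_sum ler_expR -mulr_sumr.
  by apply/idP/idP => h; lra.
apply: le_trans (sampled_prod_tail (q := expR (eta * K%:R / 3))
  sG mG GS mM mp p_ge0 PM _ _ _ (expR_gt0 _)) _.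
- move=> i j iT; apply: (measurableT_comp (@measurable_expR R)).
  apply: measurable_funM; first exact: measurable_cst.
  apply: measurable_funM; first exact: mc.
  by apply: measurable_fun_posV; [move=> w; exact/ltW/prob_gt0|exact: mp].
- by move=> *; exact: expR_ge0.
- move=> i w iT; apply: le_trans (expR_ge1Dx _).
  apply: (@le_trans _ _ (\sum_j (p i j w + eta / 3))); last first.
    rewrite big_split/= sum_p lerD2l sumr_const card_ord.
    by rewrite -[leLHS]mulr_natr mulrAC.
  apply: ler_sum => j _; have p0 := prob_gt0 T (M ^~ w) (cost w) i j.
  have /andP[c0 c1] := play_cost_bound play j w iT.
  have := eta_p j w small iT; set ip := (p i j w)^-1 => eip.
  have ip0 : 0 < ip by rewrite invr_gt0.
  have pip : p i j w * ip = 1 by rewrite divff// gt_eqF.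
  have cip : eta * (c i j w * ip) <= 3.
    by rewrite mulrCA; apply: le_trans eip; rewrite ler_piMl// mulr_ge0// ltW.
  have cip0 : 0 <= eta * (c i j w * ip) by rewrite !mulr_ge0// ltW.
  have e6 : eta / 6 * (c i j w * ip) = (eta * (c i j w * ip)) / 6 by field.
  have h : Y i j w <= 1 + 2 * (eta / 6 * (c i j w * ip)).
    by apply: expR_le_double; rewrite e6; lra.
  apply: le_trans (ler_wpM2l (ltW p0) h) _.
  rewrite mulrDr mulr1 lerD2l.
  have -> : p i j w * (2 * (eta / 6 * (c i j w * ip))) =
    eta / 3 * (p i j w * ip) * c i j w by field.
  by rewrite pip mulr1 ler_piMr// divr_ge0 ?ltW.
rewrite lee_fin -expRM_natr -expRB ler_expR -(eta_KT K2 T1); lra.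
Qed.

Lemma measurable_chat j : measurable_fun setT (fun w => ch T j w).
Proof.
by apply: gmeasurable_measurable (gmeasurable_chat j (leqnn T)); [exact: sG|exact: mG].
Qed.

Lemma measurable_acct j : measurable_fun setT (fun w => ac T j w).
Proof.
by apply: gmeasurable_measurable (gmeasurable_acct j (leqnn T)); [exact: sG|exact: mG].
Qed.

Lemma measurable_cost j : measurable_fun setT (fun w => \sum_(l < T) c l j w).
Proof.
apply: measurable_sum => l.
by apply: gmeasurable_measurable (mc j (ltn_ord l)); [apply: sG|apply: mG]; exact: ltnW.
Qed.

(** Chernoff with parameter [mu * eta] for the martingale formed by [chat + acct] minus the true
    cost of arm [j], restricted to paths whose account stays below [b * theta], where [1 / p] is at
    most [3 K (1 + b)^(3/2)]. *)
Lemma underestimation_tail j (mu b D : R) : K%:R * ln K%:R <= theta ->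
  0 <= mu <= 1 / 30 -> 0 <= b ->
  (P ([set w | ac T j w <= b * theta] `&`
     [set w | D * theta <=
        ch T j w + ac T j w - \sum_(l < T) c l j w])%R <=
   (expR (ln K%:R * (2 * mu ^+ 2 * Num.sqrt (1 + b) ^+ 3 - mu * D)))%:E)%E.
Proof.
move=> small /andP[mu0 mu1] b0.
(* Killing the factor once the account exceeds [b * theta] gives a bound on the conditional mean
   valid everywhere. Accounts never decrease, so no factor vanishes on the event considered. *)
pose Y i k w := if ac i j w <= b * theta then
  expR (mu * eta * ((j == k)%:R * (c i k w / p i k w) - c i j w)) else 0.
pose q := expR (2 * (mu * eta) ^+ 2 * (K%:R * Num.sqrt (1 + b) ^+ 3)).
have mY i k : (i < T)%N -> gmeasurable (G i) (Y i k).
  move=> iT; have iT' := ltnW iT; apply: measurable_fun_ifT.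
  - apply: measurable_fun_ler; last exact: measurable_cst.
    exact: gmeasurable_acct.
  - apply: (measurableT_comp (@measurable_expR R)).
    apply: measurable_funM; first exact: measurable_cst.
    apply: measurable_funB; last exact: mc.
    apply: measurable_funM; first exact: measurable_cst.
    apply: measurable_funM; first exact: mc.
    by apply: measurable_fun_posV; [move=> w; exact/ltW/prob_gt0|exact: mp].
  - exact: measurable_cst.
have Y0 i k w : (i < T)%N -> 0 <= Y i k w.
  by move=> _; rewrite /Y; case: ifP => // _; exact: expR_ge0.
have pY i w : (i < T)%N -> \sum_k p i k w * Y i k w <= q.
  move=> iT; rewrite /Y; have [acb|_] := boolP (ac i j w <= b * theta); last first.
    by rewrite big1 ?expR_ge0// => k _; rewrite mulr0.
  have pj0 := prob_gt0 T (M ^~ w) (cost w) i j.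
  have ej := eta_p j w small iT.
  have /andP[c0 c1] := play_cost_bound play j w iT.
  set y := mu * eta * (c i j w / p i j w).
  have yE : y = mu * (c i j w * (eta * (p i j w)^-1)) by rewrite /y; ring.
  have ep0 : 0 <= eta * (p i j w)^-1 by rewrite mulr_ge0 ?invr_ge0 ?ltW.
  (* From [mu <= 1/30] and [eta / p <= 3]. *)
  have y01 : 0 <= y <= 1 / 10.
    have ce0 : 0 <= c i j w * (eta * (p i j w)^-1) by rewrite mulr_ge0.
    have ce3 : c i j w * (eta * (p i j w)^-1) <= 3.
      by apply: le_trans ej; exact: ler_piMl.
    rewrite yE mulr_ge0//=; apply: (@le_trans _ _ (1 / 30 * 3)); last by lra.
    exact: ler_pM.
  have -> : \sum_k p i k w *
      expR (mu * eta * ((j == k)%:R * (c i k w / p i k w) - c i j w)) =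
      expR (- (mu * eta * c i j w)) * (1 + p i j w * (expR y - 1)).
    have pr : \sum_(k | k != j) p i k w = 1 - p i j w.
      by rewrite -(sum_p i w) [in RHS](bigD1 j)//= addrAC subrr add0r.
    rewrite (bigD1 j)//= eqxx mul1r.
    rewrite (eq_bigr (fun k => p i k w * expR (- (mu * eta * c i j w)))).
      by rewrite -mulr_suml pr mulrBr -/y expRD; ring.
    by move=> k /negPf; rewrite eq_sym => ->; rewrite mul0r add0r mulrN.
  have Bk : (p i j w)^-1 <= 3 * (K%:R * Num.sqrt (1 + b) ^+ 3).
    apply: (@le_trans _ _ (3 / threshold K T (ac i j w))).
      by apply: invr_prob_le => //; [exact: play_cost01|exact: ltnW].
    have a0 : 0 <= ac i j w by apply: acct_ge0 (ltnW iT) => //; exact: play_cost01.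
    rewrite ler_pM2l//; apply: le_trans (invr_threshold_le K2 T1 a0) _.
    rewrite ler_pM2l// lerXn2r ?nnegrE ?sqrtr_ge0// ler_wsqrtr// lerD2l.
    by rewrite ler_pdivrMr.
  have ey := expR_le_quadratic y01.
  have pyE : p i j w * y = mu * eta * c i j w.
    by rewrite /y; field; rewrite gt_eqF.
  (* The linear term [p y = mu eta c] cancels against the centring factor. What remains is
     [2/3 (mu eta)^2 c^2 / p], and [1 / p <= 3 K (1 + b)^(3/2)] turns [2/3] into the 2 of [q]. *)
  have : 1 + p i j w * (expR y - 1) <=
      expR (mu * eta * c i j w + 2 / 3 * (p i j w * y ^+ 2)).
    apply: le_trans (expR_ge1Dx _); rewrite lerD2l -pyE.
    have -> : p i j w * y + 2 / 3 * (p i j w * y ^+ 2) =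
      p i j w * (1 + y + 2 / 3 * y ^+ 2 - 1) by ring.
    by rewrite ler_pM2l// lerD2r.
  rewrite -(ler_pM2l (expR_gt0 (- (mu * eta * c i j w)))) => /le_trans; apply.
  rewrite -expRD addKr /q ler_expR.
  have -> : p i j w * y ^+ 2 = (mu * eta) ^+ 2 * (c i j w ^+ 2 * (p i j w)^-1).
    by rewrite /y; field; rewrite gt_eqF.
  have : c i j w ^+ 2 * (p i j w)^-1 <= 3 * (K%:R * Num.sqrt (1 + b) ^+ 3).
    apply: le_trans Bk; rewrite ler_piMl ?invr_ge0 ?(ltW pj0)//.
    by rewrite expr_le1.
  have me0 : 0 <= 2 / 3 * (mu * eta) ^+ 2 by rewrite mulr_ge0 ?sqr_ge0.
  move=> h; rewrite [leLHS]mulrA [leRHS](_ : _ = 2 / 3 * (mu * eta) ^+ 2 *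
    (3 * (K%:R * Num.sqrt (1 + b) ^+ 3))); last by field.
  exact: ler_wpM2l.
apply: (@le_trans _ _ (P [set w | expR (mu * eta * (D * theta)) <=
    \prod_(l < T) Y l (M l w) w])); last first.
  apply: le_trans (sampled_prod_tail sG mG GS mM mp p_ge0 PM mY Y0 pY
    (expR_gt0 _)) _.
  rewrite lee_fin -expRM_natr -expRB ler_expR -(eta_theta K2 T1).
  rewrite le_eqVlt; apply/orP; left; apply/eqP.
  (* The variance over all rounds carries [eta^2 K T = eta theta = ln K]. *)
  transitivity (2 * mu ^+ 2 * Num.sqrt (1 + b) ^+ 3 * (eta * (eta * (K%:R * T%:R))) -
    mu * eta * D * theta); first by ring.
  by rewrite eta_KT//; ring.
have mch := measurable_chat j; have mac := measurable_acct j.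
have mS := measurable_cost j.
have mV : measurable_fun setT (fun w => \prod_(l < T) Y l (M l w) w).
  apply: measurable_prod => l _.
  apply: gmeasurable_measurable (gmeasurable_sampled sG GS mM (ltn_ord l)
    (fun k => mY l k (ltn_ord l))).
    exact: sG.
  exact: mG.
apply: le_measure; rewrite ?inE.
- apply: measurableI; first exact: measurable_le_fun.
  by apply: measurable_ge_fun; apply: measurable_funB => //; exact: measurable_funD.
- exact: measurable_ge_fun.
move=> w [/= acb Db].
rewrite (eq_bigr (fun l : 'I_T => expR (mu * eta *
    ((j == M l w)%:R * est l w - c l j w)))); last first.
  move=> l _; rewrite /Y ifT//; apply: le_trans acb.
  by apply: acct_homo => //; [exact: play_cost01|exact: ltnW].
rewrite -expR_sum ler_expR -mulr_sumr ler_wpM2l ?mulr_ge0 ?(ltW eta0)//.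
by rewrite big_split/= sumrN -chat_acctE.
Qed.

(** A crude bound that makes the number of peels finite; its value disappears from the final
    estimate, where the peels are summed geometrically. *)
Lemma acct_ub j w : K%:R * ln K%:R <= theta -> ac T j w <= T%:R * (3 / eta).
Proof.
move=> small.
suff : forall i, (i <= T)%N -> ac i j w <= i%:R * (3 / eta) by move/(_ T (leqnn T)).
elim=> [_|i IH iT]; first by rewrite acct0 mul0r.
rewrite acctS -[i.+1]addn1 natrD mulrDl mul1r.
apply: lerD; first exact/IH/ltnW.
case: ifP => _; first by rewrite divr_ge0// ltW.
case: eqP => [_|_]; last by rewrite mul0r divr_ge0// ltW.
have /andP[c0 c1] := play_cost01 w iT.
rewrite mul1r ler_pdivlMr//; apply: le_trans (eta_p (M i w) w small iT).
rewrite /estimate mulrC ler_pM2l//; apply: ler_piMl => //.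
by rewrite invr_ge0 ltW// prob_gt0.
Qed.

Lemma underestimation_bound j (s : R) : K%:R * ln K%:R <= theta -> 8 <= s ->
  (P [set w | (s ^+ 2 * theta <= ch T j w - \sum_(l < T) c l j w)%R] <=
   (33 * expR (- (s * ln K%:R / 8)))%:E)%E.
Proof.
move=> small s8; set L := ln K%:R; have L2 : 1 / 2 <= L by exact: lnK_ge.
pose bd := s ^+ 2 + T%:R * (3 / eta) / theta.
have bd0 : 0 <= bd.
  rewrite addr_ge0 ?sqr_ge0// divr_ge0 ?(ltW theta0)// mulr_ge0//.
  by rewrite divr_ge0// ltW.
pose N := Num.bound bd.
pose B (m : 'I_N) := let t := s + m%:R in
  [set w | ac T j w <= ((t + 1) ^+ 2 - s ^+ 2) * theta] `&`
  [set w | t ^+ 2 * theta <= ch T j w + ac T j w - \sum_(l < T) c l j w].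
have cover w : s ^+ 2 * theta <= ch T j w - \sum_(l < T) c l j w ->
    exists m : 'I_N, B m w.
  set a := ac T j w; set z := ch T j w - _ => sz.
  have a0 : 0 <= a by apply: acct_ge0 => //; exact: play_cost01.
  have aub : s ^+ 2 + a / theta <= bd.
    by rewrite lerD2l ler_pM2r ?invr_gt0//; exact: acct_ub.
  have at0 : 0 <= a / theta by rewrite divr_ge0// ltW.
  (* The induction finds the last [m] for which the square of [s + m] does not exceed
     [s^2 + a / theta]; its base case is contradictory since [a >= 0]. *)
  suff peel n : s ^+ 2 + a / theta < (s + n%:R) ^+ 2 -> exists2 m : nat, (m < n)%N &
      (s + m%:R) ^+ 2 <= s ^+ 2 + a / theta <= (s + m%:R + 1) ^+ 2.
    have [|m mN /andP[lo hi]] := peel N.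
      apply: le_lt_trans aub _; apply: lt_le_trans (archi_boundP bd0) _.
      rewrite -/N; have n0 : 0 <= N%:R :> R by exact: ler0n.
      by nra.
    exists (Ordinal mN); rewrite /B /=; split.
      rewrite -/a -ler_pdivrMr//; lra.
    (* Adding the account to a deviation of at least [s^2 theta] raises it to [(s + m)^2 theta],
       which is what makes the peels increasingly unlikely. *)
    have : (s + m%:R) ^+ 2 * theta <= (s ^+ 2 + a / theta) * theta by rewrite ler_pM2r.
    rewrite mulrDl mulfVK ?gt_eqF// => h; apply: le_trans h _.
    by rewrite addrAC -/z lerD2r.
  elim: n => [|n IH]; first by rewrite addr0; lra.
  move=> lt; have [/IH[m mn mP]|le] := ltP (s ^+ 2 + a / theta) ((s + n%:R) ^+ 2).
    by exists m => //; exact: ltnW.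
  by exists n => //; rewrite le/= -addrA natr1 ltW.
have mB (m : 'I_N) : measurable (B m).
  have mch := measurable_chat j; have mac := measurable_acct j.
  have mS := measurable_cost j.
  apply: measurableI; first exact: measurable_le_fun.
  by apply: measurable_ge_fun; apply: measurable_funB => //; exact: measurable_funD.
apply: le_trans (measure_cover_le (B := B) (u := fun m : 'I_N =>
    expR (- (s * L / 8)) * expR (- (m%:R * L / 16))) _ mB cover _) _.
- apply: measurable_ge_fun; apply: measurable_funB; first exact: measurable_chat.
  exact: measurable_cost.
- move=> m; pose t := s + m%:R; have m0 : 0 <= m%:R :> R by exact: ler0n.
  have st : s <= t by rewrite /t lerDl.
  apply: le_trans (underestimation_tail (mu := (4 * t)^-1) j _ small _ _) _.
  + rewrite invr_ge0; apply/andP; split; first by rewrite /t; lra.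
    by rewrite div1r lef_pV2 ?posrE; rewrite /t; lra.
  + by nra.
  rewrite lee_fin -expRD ler_expR -/L.
  (* As [t = s + m], the exponent separates into the announced tail and a geometric factor in
     [m]. *)
  have -> : - (s * L / 8) + - (m%:R * L / 16) = L * (- ((s + t) / 16)).
    by rewrite /t; field.
  by rewrite ler_pM2l; [exact: peel_exponent_le|lra].
rewrite lee_fin -mulr_sumr [leRHS]mulrC ler_wpM2l ?expR_ge0//.
exact: geometric_sum_le.
Qed.

End play.

(** * The tail of the regret *)

Lemma inf_range_attained (R : realType) (I : finType) (f : I -> R) (i0 : I) :
  exists2 j, inf (range f) = f j & forall i, f j <= f i.
Proof.
pose j := [arg min_(i < i0) f i]%O.
have jmin i : f j <= f i by rewrite /j; case: arg_minP => // k _ h; exact: h.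
exists j => //; apply/eqP; rewrite eq_le; apply/andP; split.
  by apply: ge_inf; [exists (f j) => _ [i _ <-]|exists j].
by apply: lb_le_inf; [exists (f j), j|move=> _ [i _ <-]].
Qed.

Section regret.
Context (R : realType) (K T : nat) (d : measure_display)
  (Omega : measurableType d) (P : probability Omega R)
  (G : nat -> set (set Omega)) (M : nat -> Omega -> 'I_K)
  (c : nat -> 'I_K -> Omega -> R).
Hypotheses (K2 : (2 <= K)%N) (T1 : (1 <= T)%N).
Hypothesis play : accounts_play P T G M c.
Local Notation theta := (theta R K T).
Local Notation L := (ln K%:R : R).

Let arm0 : 'I_K := Ordinal (leq_trans (ltnW (ltnSn 1)) K2).

Lemma regretE w : exists2 j : 'I_K,
  regret T M c w = \sum_(i < T) c i (M i w) w - \sum_(i < T) c i j w &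
  forall k, \sum_(i < T) c i j w <= \sum_(i < T) c i k w.
Proof.
have [j e h] := inf_range_attained (fun j : 'I_K => \sum_(i < T) c i j w) arm0.
by exists j; rewrite // /regret e.
Qed.

Lemma regret_le_rounds w : regret T M c w <= T%:R.
Proof.
have [j -> _] := regretE w.
apply: (@le_trans _ _ (\sum_(i < T) c i (M i w) w)).
  rewrite gerBl; apply: sumr_ge0 => i _.
  by case/andP: (play_cost_bound play j w (ltn_ord i)).
rewrite -[T in T%:R]card_ord -sumr_const; apply: ler_sum => i _.
by case/andP: (play_cost_bound play (M i w) w (ltn_ord i)).
Qed.

(** The regret is the largest of [K] measurable differences, so its upper level sets are finite
    unions. *)
Lemma measurable_regret : measurable_fun setT (regret T M c).
Proof.
apply: (@measurability _ _ _ _ _ _ (@RGenCInfty.G R)).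
  exact: RGenCInfty.measurableE.
move=> _ [_ [x ->] <-].
rewrite setTI.
have -> : regret T M c @^-1` `[x, +oo[%classic = \big[setU/set0]_(j : 'I_K)
    [set w | x <= \sum_(i < T) c i (M i w) w - \sum_(i < T) c i j w].
  rewrite -bigcup_seq; apply/seteqP; split => w /=; rewrite in_itv/= andbT.
    have [j -> _] := regretE w; exists j => //=; exact: mem_index_enum.
  move=> [k _ /= h]; have [j -> jmin] := regretE w; apply: le_trans h _.
  by rewrite lerD2l lerN2.
apply: bigsetU_measurable => j _; apply: measurable_ge_fun.
apply: measurable_funB; last exact: measurable_cost play j.
apply: measurable_sum => i; have iT := ltn_ord i.
have [sG mG] := (play_sigma play, play_measurable play).
apply: gmeasurable_measurable (sG _ iT) (mG _ iT) _.
apply: (gmeasurable_sampled sG (play_mono play) (play_arm play) iT (f := c i)) => k.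
apply/(gmeasurableP _ (sG _ (ltnW iT))) => B mB; exact: (play_cost play).
Qed.

Let L2 : 1 / 2 <= L. Proof. exact: lnK_ge. Qed.
Let K2R : 2 <= K%:R :> R. Proof. exact: natK_ge2. Qed.
Let theta0 : 0 < theta. Proof. exact: theta_gt0. Qed.

Let L0 : 0 < L. Proof. by have := L2; lra. Qed.
Let K0 : 0 < K%:R :> R. Proof. by have := K2R; lra. Qed.
Let KL0 : 0 < K%:R * L. Proof. exact: mulr_gt0. Qed.

Lemma regret_tail_long (s : R) : 8 <= s -> (s ^+ 2 + 7) * (K%:R * L) <= theta ->
  (P [set w | ((s ^+ 2 + 7) * theta <= regret T M c w)%R] <=
   (34 * K%:R * expR (- (s * L / 8)))%:E)%E.
Proof.
move=> s8 long; have L2' := L2; have K2R' := K2R; have KL0' := KL0.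
have s64 : 64 <= s ^+ 2 by nra.
(* The constant 71 of the path analysis is [8^2 + 7]. *)
have small71 : 71 * (K%:R * L) <= theta.
  by apply: le_trans long; rewrite ler_pM2r//; lra.
have small : K%:R * L <= theta by lra.
(* One event for the sum of all estimates and one per arm: if the former fails, the regret bound
   forces the latter for the best arm. *)
pose B (o : unit + 'I_K) := if o is inr j then
  [set w | s ^+ 2 * theta <= chat T (M ^~ w) (fun l => c l (M l w) w) T j -
     \sum_(l < T) c l j w]
  else [set w | 3 * theta <= eta R K T *
    \sum_(l < T) estimate T (M ^~ w) (fun l => c l (M l w) w) l].
pose u (o : unit + 'I_K) := if o is inr j then 33 * expR (- (s * L / 8))
  else expR (- (theta / 6)).
apply: le_trans (measure_cover_le (B := B) (u := u) _ _ _ _) _.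
- exact/measurable_ge_fun/measurable_regret.
- case=> [[]|j] /=; last first.
    apply: measurable_ge_fun; apply: measurable_funB.
      exact: (measurable_chat play).
    exact: measurable_cost play j.
  apply: measurable_ge_fun; apply: measurable_funM; first exact: measurable_cst.
  rewrite (_ : (fun w => _) = (fun w =>
    \sum_j chat T (M ^~ w) (fun l => c l (M l w) w) T j +
    \sum_j acct T (M ^~ w) (fun l => c l (M l w) w) T j)); last first.
    by apply/funext => w; rewrite sum_chat_acct.
  apply: measurable_funD; apply: measurable_sum => j.
    exact: (measurable_chat play).
  exact: (measurable_acct play).
- move=> w /=; have [j -> _] := regretE w => reg.
  have := @total_cost_le R K T (M ^~ w) _ K2 T1 (play_cost01 play w) j small71.
  have [S3|S3] := leP (3 * theta) (eta R K T *
      \sum_(l < T) estimate T (M ^~ w) (fun l => c l (M l w) w) l).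
    by exists (inl tt).
  by move=> /= tot; exists (inr j) => /=; lra.
- case=> [[]|j] /=; first exact: (sum_estimate_tail K2 T1 play).
  exact: (underestimation_bound K2 T1 play).
rewrite lee_fin big_sumType/= !sumr_const card_unit card_ord mulr1n -[_ *+ K]mulr_natr.
(* In a long game the event on the sum of estimates weighs no more than one further tail, so the
   total is at most [33 K + 1 <= 34 K] tails. *)
have : expR (- (theta / 6)) <= expR (- (s * L / 8)).
  rewrite ler_expR lerN2.
  apply: (@le_trans _ _ ((s ^+ 2 + 7) * (K%:R * L) / 6)); last by lra.
  have : s * L <= (s ^+ 2 + 7) * (K%:R * L).
    by apply: ler_pM; [lra|lra|nra|rewrite ler_peMl//; lra].
  have : 0 <= (s ^+ 2 + 7) * (K%:R * L) by rewrite mulr_ge0//; lra.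
  by lra.
have e0 := expR_gt0 (- (s * L / 8)).
by move: e0; set e := expR (- (s * L / 8)) => e0 e1; nra.
Qed.

Lemma regret_tail (alpha : R) : 1 < alpha ->
  (P [set w | ((alpha + 7) * theta <= regret T M c w)%R] <=
   (1000 * K%:R * Num.sqrt alpha * expR (- (Num.sqrt alpha * L) / 8))%:E)%E.
Proof.
move=> a1; have L2' := L2; have K2R' := K2R; have KL0' := KL0; set s := Num.sqrt alpha.
have a0 : 0 <= alpha by lra.
have s2 : s ^+ 2 = alpha by rewrite sqr_sqrtr.
have s1 : 1 < s by rewrite -sqrtr1 ltr_sqrt//; lra.
have mA : measurable [set w | (alpha + 7) * theta <= regret T M c w].
  exact/measurable_ge_fun/measurable_regret.
have -> : - (s * L) / 8 = - (s * L / 8) by ring.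
have [s8|s8] := ltP s 8.
  apply: le_trans (probability_le1 P mA) _; rewrite lee_fin.
  have lnKE : K%:R = expR L :> R by rewrite lnK// posrE; lra.
  (* The left factor is [exp L], so the exponent is [L (1 - s / 8) >= 0]. *)
  have h : 1 <= K%:R * expR (- (s * L / 8)).
    rewrite [X in X * _]lnKE -expRD; apply: le_trans (expR_ge1Dx _); rewrite lerDl; nra.
  have -> : 1000 * K%:R * s * expR (- (s * L / 8)) =
    1000 * s * (K%:R * expR (- (s * L / 8))) by ring.
  by nra.
(* Because [theta^2 = K L T], the short case reads [T < (alpha + 7) theta], out of reach for a
   regret bounded by [T]. *)
have [short|long] := ltP theta ((alpha + 7) * (K%:R * L)).
  rewrite (_ : [set w | _] = set0) ?measure0.
    by rewrite lee_fin !mulr_ge0 ?ler0n ?expR_ge0 ?(ltW (lt_trans ltr01 s1)).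
  apply/seteqP; split => // w /= /(le_trans)/(_ (regret_le_rounds w)).
  apply/negP; rewrite -ltNge.
    rewrite -(ltr_pM2l KL0) mulrA [_ * (_ + 7)]mulrC.
  have <- : theta ^+ 2 = K%:R * L * T%:R by rewrite theta_sqr//; ring.
  by rewrite expr2 ltr_pM2r.
rewrite -s2 in long *; apply: le_trans (regret_tail_long s8 long) _.
rewrite lee_fin ler_wpM2r ?expR_ge0// -[leLHS]mulr1.
by apply: ler_pM => //; [rewrite ler_pM2r//; lra|lra].
Qed.

End regret.

(** * The expected regret *)

(** A discrete layer-cake inequality: after integration, the count becomes a sum of tail
    probabilities. *)
Lemma le_add_count (R : realDomainType) (a x : R) (N : nat) :
  x <= N%:R + a -> x <= a + \sum_(n < N) (n%:R + a <= x)%R%:R.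
Proof.
elim: N => [|N IH]; first by rewrite add0r big_ord0 addr0.
move=> xN; have [/IH h|Nx] := leP x (N%:R + a).
  by apply: le_trans h _; rewrite lerD2l big_ord_recr/= lerDl.
rewrite (eq_bigr (fun=> 1)) => [|n _].
  by rewrite sumr_const card_ord addrC.
rewrite (le_trans _ (ltW Nx))// lerD2r ler_nat -ltnS; exact: ltn_ord.
Qed.

(** Keeps the fifth-order term of the exponential series: with [s^2] linear in [n], the resulting
    decay [s^(-4)] is summable. *)
Lemma mul_expRN_le (R : realType) (a s : R) : 0 < a -> 0 < s ->
  s * expR (- (s / a)) <= a ^+ 5 * 5`!%:R / s ^+ 4.
Proof.
move=> a0 s0; have f0 : 0 < 5`!%:R :> R by rewrite ltr0n fact_gt0.
have h : (s / a) ^+ 5 / 5`!%:R <= expR (s / a).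
  apply: le_trans (expR_ge1Dxn 4 _); last by rewrite divr_ge0 ?ltW.
  by rewrite lerDr.
rewrite expRN ler_pdivrMr ?expR_gt0//; apply: le_trans (ler_wpM2l _ h); last first.
  by rewrite divr_ge0 ?mulr_ge0 ?exprn_ge0// ltW.
move: (5`!%:R) f0 => f f0.
rewrite le_eqVlt; apply/orP; left; apply/eqP.
by field; rewrite !gt_eqF.
Qed.

Lemma sum_telescope_le1 (R : realFieldType) (N : nat) :
  \sum_(n < N) ((n%:R + 1) * (n%:R + 2))^-1 <= 1 :> R.
Proof.
suff -> : \sum_(n < N) ((n%:R + 1) * (n%:R + 2))^-1 = 1 - (N%:R + 1)^-1 :> R.
  by rewrite gerBl invr_ge0 addr_ge0.
elim: N => [|N IH]; first by rewrite big_ord0 add0r invr1 subrr.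
have N0 : 0 <= N%:R :> R by exact: ler0n.
rewrite big_ord_recr/= IH -[N.+1]addn1 natrD; field.
by apply/andP; split; rewrite gt_eqF//; lra.
Qed.

(** The shift 256 makes the square root [s] at least 16, so [s / 8 - 1 >= s / 16]; with
    [ln K >= 1/2] the factor [K] is absorbed and [exp (- s / 32)] remains, uniformly in [K]. *)
Lemma tail_bound_summable (R : realType) : exists2 C : R, 0 <= C &
  forall K n : nat, (2 <= K)%N ->
  1000 * K%:R * Num.sqrt (n%:R + 256) *
    expR (- (Num.sqrt (n%:R + 256) * ln K%:R) / 8) <=
  C * ((n%:R + 1) * (n%:R + 2))^-1.
Proof.
have [f f0 smallexp] : exists2 f : R, 0 < f & forall s : R, 0 < s ->
    s * expR (- (s / 32)) <= f / s ^+ 4.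
  exists (32 ^+ 5 * 5`!%:R); first by rewrite mulr_gt0 ?exprn_gt0 ?ltr0n ?fact_gt0.
  by move=> s s0; apply: mul_expRN_le.
exists (1000 * f); first by apply: mulr_ge0; [exact: ler0n|exact: ltW].
move=> K n K2; set s := Num.sqrt _; have n0 : 0 <= n%:R :> R by exact: ler0n.
have L2 : 1 / 2 <= ln K%:R :> R by exact: lnK_ge.
have K2R : 2 <= K%:R :> R by exact: natK_ge2.
have s2 : s ^+ 2 = n%:R + 256 by rewrite sqr_sqrtr ?addr_ge0 ?ler0n.
have s0 : 0 <= s by exact: sqrtr_ge0.
have s16 : 16 <= s.
  by rewrite leNgt; apply/negP => lt; nra.
have lnKE : K%:R = expR (ln K%:R) :> R by rewrite lnK// posrE; lra.
have h : K%:R * expR (- (s * ln K%:R) / 8) <= expR (- (s / 32)).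
  by rewrite [X in X * _]lnKE -expRD ler_expR; nra.
have -> : 1000 * K%:R * s * expR (- (s * ln K%:R) / 8) =
    1000 * (s * (K%:R * expR (- (s * ln K%:R) / 8))) by ring.
have smalls : s * expR (- (s / 32)) <= f / s ^+ 4 by apply: smallexp; lra.
have p1000 : 0 < 1000 :> R by rewrite ltr0n.
rewrite -[leRHS]mulrA (ler_pM2l p1000).
apply: le_trans (ler_wpM2l s0 h) _; apply: le_trans smalls _.
rewrite ler_wpM2l ?(ltW f0)//.
have n12 : 0 < (n%:R + 1) * (n%:R + 2) :> R by rewrite mulr_gt0; lra.
have s4 : 0 < s ^+ 4 by rewrite exprn_gt0//; lra.
rewrite lef_pV2 ?posrE//.
by rewrite -[4%N]/(2 * 2)%N exprM s2; nra.
Qed.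

Lemma expected_regret_le (R : realType) : exists C : R,
  forall (K T : nat) (d : measure_display)
  (Omega : measurableType d) (P : probability Omega R)
  (G : nat -> set (set Omega)) (M : nat -> Omega -> 'I_K)
  (c : nat -> 'I_K -> Omega -> R),
  (2 <= K)%N -> (1 <= T)%N -> accounts_play P T G M c ->
  ('E_P[regret T M c] <= (C * theta R K T)%:E)%E.
Proof.
have [C1 C10 C1P] := tail_bound_summable R; exists (263 + C1).
move=> K T d Omega P G M c K2 T1 play; set th := theta R K T.
have th0 : 0 < th by exact: theta_gt0.
have mreg := measurable_regret K2 play.
(* The regret is at most [T], so finitely many levels suffice; the bound on their sum does not
   depend on [N]. *)
pose N := Num.bound (T%:R / th).
pose A n := [set w | (n%:R + 256 + 7) * th <= regret T M c w].
have mA n : measurable (A n) by exact: measurable_ge_fun.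
pose g w := th * (263 + \sum_(n < N) \1_(A n) w).
have g0 w : 0 <= g w.
  by rewrite mulr_ge0 ?(ltW th0) ?addr_ge0 ?ler0n ?sumr_ge0.
have mg : measurable_fun setT g.
  apply: measurable_funM; first exact: measurable_cst.
  apply: measurable_funD; first exact: measurable_cst.
  by apply: measurable_sum => n; exact: measurable_indic.
have rg w : regret T M c w <= g w.
  have TN : T%:R / th <= N%:R by apply/ltW/archi_boundP; rewrite divr_ge0// ltW.
  have rN : regret T M c w / th <= N%:R + 263.
    apply: (@le_trans _ _ (T%:R / th)).
      by rewrite ler_pM2r ?invr_gt0//; exact: (regret_le_rounds K2 play).
    by apply: le_trans TN _; rewrite lerDl ler0n.
  rewrite /g mulrC -ler_pdivrMr//; apply: le_trans (le_add_count rN) _.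
  rewrite lerD2l; apply: ler_sum => n _.
  have [h|_] := boolP (n%:R + 263 <= _); last exact: ler0n.
  rewrite indicE mem_set// /A /= -ler_pdivlMr// -addrA.
  by rewrite (_ : 256 + 7 = 263 :> R)//; ring.
rewrite unlock integralE.
apply: (@le_trans _ _ (\int[P]_w (g w)%:E)%E).
  (* The regret may be negative, so its integral is a difference of two integrals; dropping the
     negative part only increases it. *)
  apply: (@le_trans _ _ (\int[P]_w ((fun w => (regret T M c w)%:E)^\+ w))%E).
    by rewrite geeDl// oppe_le0 integral_ge0.
  apply: ge0_le_integral => //.
  - by apply: measurable_funepos; exact/measurable_EFinP.
  - exact/measurable_EFinP.
  - move=> w _; rewrite funeposE ge_max lee_fin rg/=.
    by rewrite lee_fin g0.
under eq_integral do rewrite EFinM.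
rewrite ge0_integralZl//; last 3 first.
- apply/measurable_EFinP; apply: measurable_funD; first exact: measurable_cst.
  by apply: measurable_sum => n; exact: measurable_indic.
- by move=> w _; rewrite lee_fin addr_ge0//; apply: sumr_ge0.
- by rewrite lee_fin ltW.
rewrite [leRHS]EFinM [leRHS]muleC lee_wpmul2l ?lee_fin ?(ltW th0)//.
under eq_integral do rewrite EFinD -sumEFin.
rewrite ge0_integralD//; last 2 first.
- by move=> w _; apply: sume_ge0 => n _; rewrite lee_fin.
- by apply: emeasurable_sum => n; exact/measurable_EFinP/measurable_indic.
rewrite [leRHS]EFinD; apply: leeD.
  by rewrite integral_cst//= probability_setT mule1.
rewrite ge0_integral_sum//; last first.
  by move=> n; exact/measurable_EFinP/measurable_indic.
apply: (@le_trans _ _ (\sum_(n < N) (C1 * ((n%:R + 1) * (n%:R + 2))^-1)%:E)%E).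
  apply: lee_sum => n _; rewrite integral_indic// setIT.
  apply: le_trans (regret_tail K2 T1 play _) _.
    by have := ler0n R n; lra.
  by rewrite lee_fin; exact: C1P.
rewrite sumEFin lee_fin -mulr_sumr -[leRHS]mulr1 ler_wpM2l//.
exact: sum_telescope_le1.
Qed.

Theorem theorem1p1 (R : realType) :
  (forall (K T : nat) (d : measure_display) (Omega : measurableType d)
      (P : probability Omega R) (G : nat -> set (set Omega))
      (M : nat -> Omega -> 'I_K) (c : nat -> 'I_K -> Omega -> R),
    (2 <= K)%N -> (1 <= T)%N -> accounts_play P T G M c ->
    forall alpha : R, 1 < alpha ->
      (P [set w | ((alpha + 7) * Num.sqrt (T%:R * K%:R * ln K%:R)
                   <= regret T M c w)%R]
       <= (1000 * K%:R * Num.sqrt alpha *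
             expR (- (Num.sqrt alpha * ln K%:R) / 8))%:E)%E)
  /\
  (exists C : R,
    forall (K T : nat) (d : measure_display) (Omega : measurableType d)
      (P : probability Omega R) (G : nat -> set (set Omega))
      (M : nat -> Omega -> 'I_K) (c : nat -> 'I_K -> Omega -> R),
    (2 <= K)%N -> (1 <= T)%N -> accounts_play P T G M c ->
      ('E_P[regret T M c] <= (C * Num.sqrt (T%:R * K%:R * ln K%:R))%:E)%E).
Proof.
have thetaC (K T : nat) : Num.sqrt (T%:R * K%:R * ln K%:R) = theta R K T.
  by rewrite /theta [T%:R * _]mulrC.
split=> [K T d Omega P G M c K2 T1 play alpha a1|].
  by rewrite thetaC; exact: regret_tail play alpha a1.
have [C CP] := expected_regret_le R; exists C.
by move=> K T d Omega P G M c K2 T1 play; rewrite thetaC; exact: CP play.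
Qed.
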